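(* Let $\mathcal{H}$ be a real Hilbert space, let $m$ be a strictly positive integer, let $z\in\mathcal{H}$, let $A:\mathcal{H}\to2^{\mathcal{H}}$ be maximally monotone, and let $C:\mathcal{H}\to\mathcal{H}$ be monotone and $v_0$-Lipschitzian for some $v_0\in(0,+\infty)$. For every $i\in\{1,\dots,m\}$, let $\mathcal{G}_i$ be a real Hilbert space, let $r_i\in\mathcal{G}_i$, let $B_i:\mathcal{G}_i\to2^{\mathcal{G}_i}$ be maximally monotone, and let $L_i:\mathcal{H}\to\mathcal{G}_i$ be a nonzero bounded linear operator. Suppose that $$z\in\operatorname{ran}\Big(A+\sum_{i=1}^mL_i^*\big(B_i(L_i\cdot-r_i)\big)+C\Big).$$ Consider the primal inclusion $$\text{(P)}\quad\text{find }\bar{x}\in\mathcal{H}\text{ such that } z\in A\bar{x}+\sum_{i=1}^mL_i^*\big(B_i(L_i\bar{x}-r_i)\big)+C\bar{x}$$ and the dual inclusion $$\text{(D)}\quad\text{find }\bar{v}_1\in\mathcal{G}_1,\dots,\bar{v}_m\in\mathcal{G}_m\text{ such that }(\exists x\in\mathcal{H})\ \begin{cases}z-\sum_{i=1}^mL_i^*\bar{v}_i\in Ax+Cx,\\(\forall i\in\{1,\dots,m\})\ \bar{v}_i\in B_i(L_ix-r_i).\end{cases}$$ Let $\alpha\in(0,+\infty)$, let $(\eta_{0,n})_{n\in\mathbb{N}}$ be a sequence in $\ell^1_+(\mathbb{N})$, let $(U_n)_{n\in\mathbb{N}}$ be a sequence in $\mathcal{P}_\alpha(\mathcal{H})$,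 and for every $i\in\{1,\dots,m\}$ let $(\eta_{i,n})_{n\in\mathbb{N}}$ be a sequence in $\ell^1_+(\mathbb{N})$ and $(U_{i,n})_{n\in\mathbb{N}}$ a sequence in $\mathcal{P}_\alpha(\mathcal{G}_i)$, such that $\mu=\sup_{n\in\mathbb{N}}\{\|U_n\|,\|U_{1,n}\|,\dots,\|U_{m,n}\|\}<+\infty$ and, for every $n\in\mathbb{N}$, $$(1+\eta_{0,n})U_{n+1}\succcurlyeq U_n\quad\text{and}\quad(\forall i\in\{1,\dots,m\})\ (1+\eta_{i,n})U_{i,n+1}\succcurlyeq U_{i,n}.$$ Let $(a_{1,n})_{n\in\mathbb{N}},(b_{1,n})_{n\in\mathbb{N}},(c_{1,n})_{n\in\mathbb{N}}$ be absolutely summable sequences in $\mathcal{H}$ and, for every $i\in\{1,\dots,m\}$, let $(a_{2,i,n})_{n\in\mathbb{N}},(b_{2,i,n})_{n\in\mathbb{N}},(c_{2,i,n})_{n\in\mathbb{N}}$ be absolutely summable sequences in $\mathcal{G}_i$. Set $$\beta=v_0+\sqrt{\sum_{i=1}^m\|L_i\|^2},$$ let $x_0,p_{1,-1}\in\mathcal{H}$, let $(v_{1,0},\dots,v_{m,0})$ and $(p_{2,1,-1},\dots,p_{2,m,-1})$ be in $\mathcal{G}_1\oplus\dots\oplus\mathcal{G}_m$, let $\lambda<\frac{1}{\sqrt{10}\,\mu\beta}$ and let $(\gamma_n)_{n\in\mathbb{N}}$ be a sequence in $(0,\lambda]$ with $\liminf_{n\to+\infty}\gamma_n>0$. For every $n\in\mathbb{N}$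 set $$\begin{aligned} &y_{1,n}=x_n-\gamma_nU_n\Big(C(p_{1,n-1})+\sum_{i=1}^mL_i^*(p_{2,i,n-1})+a_{1,n}\Big),\\ &\text{for } i=1,\dots,m:\ \begin{cases}y_{2,i,n}=v_{i,n}+\gamma_nU_{i,n}\big(L_i(p_{1,n-1})+a_{2,i,n}\big),\\ p_{2,i,n}=J_{\gamma_nU_{i,n}B_i^{-1}}(y_{2,i,n}-\gamma_nU_{i,n}r_i)+b_{2,i,n},\end{cases}\\ &p_{1,n}=J_{\gamma_nU_nA}(y_{1,n}+\gamma_nU_nz)+b_{1,n},\\ &\text{for } i=1,\dots,m:\ \begin{cases}q_{2,i,n}=p_{2,i,n}+\gamma_nU_{i,n}\big(L_i(p_{1,n})+c_{2,i,n}\big),\\ v_{i,n+1}=v_{i,n}-y_{2,i,n}+q_{2,i,n},\end{cases}\\ &q_{1,n}=p_{1,n}-\gamma_nU_n\Big(C(p_{1,n})+\sum_{i=1}^mL_i^*(p_{2,i,n})+c_{1,n}\Big),\\ &x_{n+1}=x_n-y_{1,n}+q_{1,n}. \end{aligned}$$ Then the following hold. (i) $\sum_{n\in\mathbb{N}}\|x_n-p_{1,n}\|^2<+\infty$ and, for every $i\in\{1,\dots,m\}$, $\sum_{n\in\mathbb{N}}\|v_{i,n}-p_{2,i,n}\|^2<+\infty$. (ii) There exist a solution $\bar{x}$ to (P) and a solution $(\bar{v}_1,\dots,\bar{v}_m)$ to (D) such that: (1) $x_n\rightharpoonup\bar{x}$ and $p_{1,n}\rightharpoonup\bar{x}$;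 (2) for every $i\in\{1,\dots,m\}$, $v_{i,n}\rightharpoonup\bar{v}_i$ and $p_{2,i,n}\rightharpoonup\bar{v}_i$.
   Context: $\mathbb{N}=\{0,1,2,\dots\}$. $\langle\cdot,\cdot\rangle$ and $\|\cdot\|$ denote scalar products and norms of the Hilbert spaces (and $\|\cdot\|$ also operator norms); $\rightharpoonup$ denotes weak convergence; $Id$ is the identity; $L^*$ is the adjoint of $L$; $\mathcal{G}_1\oplus\dots\oplus\mathcal{G}_m$ is the Hilbert direct sum. $\ell^1_+(\mathbb{N})$ is the set of summable sequences in $[0,+\infty)$; a sequence $(a_n)$ in a Hilbert space is absolutely summable if $\sum_n\|a_n\|<+\infty$. For self-adjoint bounded linear operators $U,V$ on a real Hilbert space $\mathcal{K}$, $U\succcurlyeq V$ means $\langle Ux,x\rangle\ge\langle Vx,x\rangle$ for all $x\in\mathcal{K}$, and $\mathcal{P}_\alpha(\mathcal{K})$ is the set of self-adjoint bounded linear operators $U$ on $\mathcal{K}$ with $U\succcurlyeq\alpha\,Id$. A set-valued operator $A:\mathcal{K}\to2^{\mathcal{K}}$ has graph $\{(x,u):u\in Ax\}$, range $\operatorname{ran}A=\{u:(\exists x)\ u\in Ax\}$, and inverse $A^{-1}$ with graph $\{(u,x):u\in Ax\}$. It is monotone if $\langle x-y,u-v\rangle\ge0$ for all $(x,u),(y,v)$ in its graph, and maximally monotone if it is monotone and no monotone operator has a graph properly containing its graph. The resolvent of $A$ is $J_A=(Id+A)^{-1}$. An operator $C:\mathcal{K}\to\mathcal{K}$ is $v_0$-Lipschitzian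 if $\|Cx-Cy\|\le v_0\|x-y\|$ for all $x,y$. For $U\in\mathcal{P}_\alpha(\mathcal{K})$ and $\gamma>0$, $\gamma UA$ is the operator $x\mapsto\{\gamma Uu:u\in Ax\}$; for $A$ maximally monotone its resolvent $J_{\gamma UA}$ is single-valued and defined on all of $\mathcal{K}$. *)

(* Defs.v *)
From HB Require Import structures.
From mathcomp Require Import all_boot all_order all_algebra.
From mathcomp Require Import all_classical all_reals all_analysis.

Set Implicit Arguments.
Unset Strict Implicit.
Unset Printing Implicit Defensive.

Import Order.TTheory GRing.Theory Num.Theory.
Import numFieldNormedType.Exports.

Local Open Scope classical_set_scope.
Local Open Scope ring_scope.

(* Positivity and definiteness of the scalar product follow from [inner_sqr]. *)
HB.mixin Record CompleteNormedModule_isHilbert (R : realType) V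
    of CompleteNormedModule R V := {
  inner : V -> V -> R;
  innerC : forall x y, inner x y = inner y x;
  innerDl : forall x y z, inner (x + y) z = inner x z + inner y z;
  innerZl : forall a x y, inner (a *: x) y = a * inner x y;
  inner_sqr : forall x, inner x x = `|x| ^+ 2
}.

#[short(type="hilbertType")]
HB.structure Definition Hilbert (R : realType) :=
  { V of CompleteNormedModule R V & CompleteNormedModule_isHilbert R V }.

Section BoundedOperators.
Context {R : realType}.

Definition bounded_op (H K : hilbertType R) (L : H -> K) : Prop :=
  exists M : R, forall x, `|L x| <= M * `|x|.

Definition opnorm (H K : hilbertType R) (L : H -> K) : R :=
  sup [set `|L x| | x in [set x | `|x| <= 1]].

(* For bounded linear [L], the defining set is a singleton by the Riesz
   representation theorem. *)
Definition adjoint (H K : hilbertType R) (L : H -> K) (y : K) : H :=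
  xget 0 [set w | forall x, inner (L x) y = inner x w].

Definition selfadjoint (K : hilbertType R) (U : K -> K) : Prop :=
  forall x y, inner (U x) y = inner x (U y).

Definition loewner_ge (K : hilbertType R) (U V : K -> K) : Prop :=
  forall x, inner (V x) x <= inner (U x) x.

Definition Pclass (K : hilbertType R) (alpha : R) : set {linear K -> K} :=
  [set U | [/\ bounded_op U, selfadjoint U
             & loewner_ge U (fun x => alpha *: x)]].

Definition weak_cvg (K : hilbertType R) (x : K ^nat) (xbar : K) : Prop :=
  forall w : K, inner (x n) w @[n --> \oo] --> inner xbar w.

Definition l1_plus : set (R ^nat) :=
  [set a | (forall n, 0 <= a n) /\ (\sum_(n <oo) (a n)%:E < +oo)%E].

Definition abs_summable (K : hilbertType R) : set (K ^nat) :=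
  [set a | (\sum_(n <oo) (`|a n|)%:E < +oo)%E].

End BoundedOperators.

Section SetValuedOperators.
Context {R : realType}.

Definition graph_op (K : hilbertType R) (A : K -> set K) : set (K * K) :=
  [set xu | A xu.1 xu.2].

Definition ran_op (K : hilbertType R) (A : K -> set K) : set K :=
  [set u | exists x, A x u].

Definition inv_op (K : hilbertType R) (A : K -> set K) : K -> set K :=
  fun u => [set x | A x u].

Definition monotone_op (K : hilbertType R) (A : K -> set K) : Prop :=
  forall x y u v, A x u -> A y v -> 0 <= inner (x - y) (u - v).

Definition max_monotone_op (K : hilbertType R) (A : K -> set K) : Prop :=
  monotone_op A /\
  forall A' : K -> set K, monotone_op A' -> ~ (graph_op A `<` graph_op A').

Definition single_op (K : hilbertType R) (C : K -> K) : K -> set K :=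
  fun x => [set C x].

Definition add_op (K : hilbertType R) (A B : K -> set K) : K -> set K :=
  fun x => [set a + b | a in A x & b in B x].

Definition sum_op (K : hilbertType R) (m : nat) (F : 'I_m -> K -> set K) :
    K -> set K :=
  fun x => [set \sum_(i < m) u i | u in [set u | forall i, F i x (u i)]].

Definition scale_op (K : hilbertType R) (gamma : R) (U : K -> K)
    (A : K -> set K) : K -> set K :=
  fun x => [set gamma *: U u | u in A x].

Definition pull_op (H K : hilbertType R) (L : H -> K) (B : K -> set K)
    (r : K) : H -> set H :=
  fun x => [set adjoint L u | u in B (L x - r)].

Definition resolvent (K : hilbertType R) (A : K -> set K) : K -> set K :=
  inv_op (add_op (single_op id) A).

(* The resolvent seen as a map. It is only meaningful where [resolvent A x] is
   a singleton, which holds everywhere for [A := scale_op gamma U M] with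
   [0 < gamma], [U] in [Pclass alpha], [0 < alpha], and [M] maximally
   monotone. *)
Definition resolvent_map (K : hilbertType R) (A : K -> set K) (x : K) : K :=
  xget 0 (resolvent A x).

Section Inclusions.
Variables (H : hilbertType R) (m : nat) (G : 'I_m -> hilbertType R).
Variables (z : H) (A : H -> set H) (C : H -> H).
Variables (B : forall i, G i -> set (G i)) (L : forall i, {linear H -> G i}).
Variable r : forall i, G i.

Definition primal_op : H -> set H :=
  add_op (add_op A (sum_op (fun i => pull_op (L i) (@B i) (r i)))) (single_op C).

Definition primal_sol (x : H) : Prop := primal_op x z.

Definition dual_sol (v : forall i, G i) : Prop :=
  exists x : H,
    add_op A (single_op C) x (z - \sum_(i < m) adjoint (L i) (v i)) /\
    forall i, B (L i x - r i) (v i).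

End Inclusions.
End SetValuedOperators.

(* The term of index [n - 1] of a sequence extended by [u_{-1} = um1]. *)
Definition prev_term (T : Type) (um1 : T) (u : nat -> T) (n : nat) : T :=
  if n is k.+1 then u k else um1.

(* Main.v *)
(** In the direct sum of [H] and the [G i], the primal-dual pair is the inclusion
    [0 \in A X + D X] with [A] maximally monotone (a product of shifts of the
    given operator and of the inverses [B i ^-1]) and [D] monotone and
    beta-Lipschitz (the sum of [C] and of a skew map built from the [L i]), and
    the algorithm is Tseng's forward-backward-forward splitting in which the first
    forward step reuses the value of [D] at the previous point [w = p_{n-1}].

    Let [S n] be the inverse of [U n] and [N n v = <S n v, v>]. For a zero [z] and
    an error-free step, monotonicity gives
    [N(x' - z) <= N(x - z) - N(x - p) + N(x' - p)], and the last term is at most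
    [(gamma mu beta)^2 N(w - p) <= (N(x - w) + N(x - p)) / 5]. Hence
    [N(x - z) + N(x - w)] decreases by at least [3/5 (N(x - w) + N(x - p))]. The
    errors and the change of metric perturb this by summable amounts, so that the
    gaps are summable and [N n (x n - z)] converges. Weak limits along
    ultrafilters, which exist by the Riesz theorem, are zeros, and Opial's argument
    shows that they all coincide. Resolvents are everywhere defined by Minty's
    theorem, which is obtained by minimizing a strongly convex function. *)

Require Import Defs.
From HB Require Import structures.
From mathcomp Require Import all_boot all_order all_algebra.
From mathcomp Require Import all_classical all_reals all_analysis.
From mathcomp Require Import ring lra.

Set Implicit Arguments.
Unset Strict Implicit.
Unset Printing Implicit Defensive.

Import Order.TTheory GRing.Theory Num.Theory.
Import numFieldNormedType.Exports.

Local Open Scope classical_set_scope.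
Local Open Scope ring_scope.

(** * Hilbert space preliminaries *)

Section InnerProduct.
Context {R : realType} {K : hilbertType R}.
Implicit Types x y z w : K.

Lemma innerDr x y z : inner x (y + z) = inner x y + inner x z.
Proof. by rewrite innerC innerDl !(innerC x). Qed.

Lemma innerZr a x y : inner x (a *: y) = a * inner x y.
Proof. by rewrite innerC innerZl innerC. Qed.

Lemma innerNl x y : inner (- x) y = - inner x y.
Proof. by rewrite -scaleN1r innerZl mulN1r. Qed.

Lemma innerNr x y : inner x (- y) = - inner x y.
Proof. by rewrite innerC innerNl innerC. Qed.

Lemma innerBl x y z : inner (x - y) z = inner x z - inner y z.
Proof. by rewrite innerDl innerNl. Qed.

Lemma innerBr x y z : inner x (y - z) = inner x y - inner x z.
Proof. by rewrite innerDr innerNr. Qed.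

Lemma inner0l x : inner 0 x = 0.
Proof. by rewrite -(scale0r x) innerZl mul0r. Qed.

Lemma inner0r x : inner x 0 = 0.
Proof. by rewrite innerC inner0l. Qed.

Lemma inner_sum (I : finType) (f : I -> K) w :
  inner (\sum_i f i) w = \sum_i inner (f i) w.
Proof.
by apply: (big_morph (fun u => inner u w)) => [u v|]; rewrite ?innerDl ?inner0l.
Qed.

Definition innerE := (@innerDl R K, innerDr, innerNl, innerNr,
  @innerZl R K, innerZr).

Lemma inner_eqP x y : (forall w, inner x w = inner y w) -> x = y.
Proof.
move=> h; apply/eqP; rewrite -subr_eq0 -normr_eq0 -sqrf_eq0 -inner_sqr.
by rewrite innerBl h subrr.
Qed.

Lemma sqr_normD x y : `|x + y| ^+ 2 = `|x| ^+ 2 + 2 * inner x y + `|y| ^+ 2.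
Proof. by rewrite -!inner_sqr !innerE (innerC y x); ring. Qed.

Lemma sqr_normB x y : `|x - y| ^+ 2 = `|x| ^+ 2 - 2 * inner x y + `|y| ^+ 2.
Proof. by rewrite sqr_normD innerNr normrN; ring. Qed.

End InnerProduct.


(** For [p > 0] the polynomial is evaluated at its minimizer [- q / p]. For [p = 0], a nonzero [q]
    would let the affine function take the value [- 1]. *)
Lemma quadratic_ge0_discriminant {R : realFieldType} (p q s : R) : 0 <= p ->
  (forall t, 0 <= p * t ^+ 2 + 2 * q * t + s) -> q ^+ 2 <= p * s.
Proof.
move=> p0 h; have [p00|p00] := eqVneq p 0.
  have [->|q0] := eqVneq q 0; first by rewrite p00 expr0n mul0r.
  have := h (- (s + 1) / (2 * q)).
  by have -> : p * (- (s + 1) / (2 * q)) ^+ 2 + 2 * q * (- (s + 1) / (2 * q)) + s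
    = -1 by [rewrite p00; field]; lra.
have pp : 0 < p by rewrite lt_neqAle eq_sym p00.
have := h (- q / p).
have -> : p * (- q / p) ^+ 2 + 2 * q * (- q / p) + s = (p * s - q ^+ 2) / p.
  by field.
by rewrite pmulr_lge0 ?invr_gt0// subr_ge0.
Qed.

(** * Self-adjoint operators with two-sided quadratic bounds *)

Section PositiveOperators.
Context {R : realType} {K : hilbertType R}.
Implicit Types (x y z w : K) (U S T : K -> K) (a M : R).

(** Metrics and their inverses are plain functions: self-adjointness alone forces linearity, by the
    lemmas that follow. *)
Definition posop a M U := selfadjoint U /\
  forall x, a * `|x| ^+ 2 <= inner (U x) x <= M * `|x| ^+ 2.

Lemma selfadjointD U x y : selfadjoint U -> U (x + y) = U x + U y.
Proof. by move=> sU; apply: inner_eqP => w; rewrite innerDl !sU innerDl. Qed.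

Lemma selfadjointZ U (t : R) x : selfadjoint U -> U (t *: x) = t *: U x.
Proof. by move=> sU; apply: inner_eqP => w; rewrite innerZl !sU innerZl. Qed.

Lemma selfadjoint0 U : selfadjoint U -> U 0 = 0.
Proof. by move=> sU; apply: inner_eqP => w; rewrite sU !inner0l. Qed.

Lemma selfadjointN U x : selfadjoint U -> U (- x) = - U x.
Proof. by move=> sU; rewrite -scaleN1r selfadjointZ// scaleN1r. Qed.

Lemma selfadjointB U x y : selfadjoint U -> U (x - y) = U x - U y.
Proof. by move=> sU; rewrite selfadjointD// selfadjointN. Qed.

(** Cauchy-Schwarz for the semi-inner product of [U], from the discriminant of
    [t |-> <U (t x + y), t x + y>]; [U := id] gives the usual inequality. *)
Lemma inner_psd_CS U x y : selfadjoint U -> (forall z, 0 <= inner (U z) z) ->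
  inner (U x) y ^+ 2 <= inner (U x) x * inner (U y) y.
Proof.
move=> sU U0; apply: quadratic_ge0_discriminant => // t.
have := U0 (t *: x + y); rewrite selfadjointD// selfadjointZ// !innerE.
by rewrite (sU y x) (innerC y); congr (0 <= _); ring.
Qed.

Lemma inner_CS x y : `|inner x y| <= `|x| * `|y|.
Proof.
have h : inner x y ^+ 2 <= inner x x * inner y y.
  by apply: (@inner_psd_CS id) => // z; rewrite inner_sqr exprn_ge0.
rewrite -ler_sqr ?nnegrE ?mulr_ge0// real_normK ?num_real// exprMn.
by rewrite -!inner_sqr.
Qed.

Lemma ler_inner x y : inner x y <= `|x| * `|y|.
Proof. by apply: le_trans (inner_CS _ _); exact: ler_norm. Qed.

(** Cauchy-Schwarz for [U] at the pair [x], [U x] gives [|U x|^4 <= <U x, x> M |U x|^2]. Stated for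
    semidefinite [U] so as to cover differences of metrics. *)
Lemma psd_sqr_le M U : selfadjoint U -> (forall x, 0 <= inner (U x) x) ->
  (forall x, inner (U x) x <= M * `|x| ^+ 2) ->
  forall x, `|U x| ^+ 2 <= M * inner (U x) x.
Proof.
move=> sU U0 UM x; have [->|Ux0] := eqVneq (U x) 0.
  by rewrite inner0l normr0 expr0n mulr0.
have p : 0 < `|U x| ^+ 2 by rewrite exprn_gt0// normr_gt0.
rewrite -(ler_pM2r p) -expr2 -{1}inner_sqr.
apply: le_trans (inner_psd_CS x (U x) sU U0) _.
by rewrite -mulrA mulrCA ler_wpM2l ?U0 ?UM.
Qed.

Section Basic.
Variables (a M : R) (U : K -> K).
Hypotheses (a0 : 0 <= a) (UP : posop a M U).

Lemma posop_sa : selfadjoint U. Proof. by case: UP. Qed.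

Lemma posop_ge x : a * `|x| ^+ 2 <= inner (U x) x.
Proof. by case: UP => _ /(_ x) /andP[]. Qed.

Lemma posop_le x : inner (U x) x <= M * `|x| ^+ 2.
Proof. by case: UP => _ /(_ x) /andP[]. Qed.

Lemma posop_ge0 x : 0 <= inner (U x) x.
Proof. by apply: le_trans (posop_ge x); rewrite mulr_ge0 ?exprn_ge0. Qed.

Lemma posop_CS x y : inner (U x) y ^+ 2 <= inner (U x) x * inner (U y) y.
Proof. exact: inner_psd_CS posop_sa posop_ge0. Qed.

Lemma posop_sqr_le x : `|U x| ^+ 2 <= M * inner (U x) x.
Proof. exact: psd_sqr_le posop_sa posop_ge0 posop_le x. Qed.

Lemma posop_norm_le x : `|U x| <= M * `|x|.
Proof.
have [->|x0] := eqVneq x 0.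
  by rewrite (selfadjoint0 posop_sa) normr0 mulr0.
have M0 : 0 <= M.
  have p : 0 < `|x| ^+ 2 by rewrite exprn_gt0// normr_gt0.
  by rewrite -(pmulr_lge0 _ p) (le_trans (posop_ge0 x))// posop_le.
rewrite -ler_sqr ?nnegrE ?mulr_ge0//.
apply: le_trans (posop_sqr_le x) _; rewrite exprMn expr2 -mulrA.
by rewrite ler_wpM2l// posop_le.
Qed.

End Basic.

Lemma posop_id : posop 1 1 (@id K).
Proof. by split=> // x; rewrite inner_sqr mul1r lexx. Qed.

Lemma posopZ a M U (t : R) : 0 <= t -> posop a M U ->
  posop (t * a) (t * M) (fun x => t *: U x).
Proof.
move=> t0 [sU UP]; split=> [x y|x]; first by rewrite innerZl innerZr sU.
by rewrite innerZl -!mulrA !ler_wpM2l//; case/andP: (UP x).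
Qed.

End PositiveOperators.

(** * Limits of scalar products along a filter *)

Section InnerLimits.
Context {R : realType} {K : hilbertType R} {T : Type} {F : set_system T}.
Context {FF : Filter F}.
Implicit Types (f g : T -> K) (x y w : K).

Lemma cvg_norm_le {V : normedModType R} (f : T -> V) (l : V) (g : T -> R) :
  (forall t, `|f t - l| <= g t) -> g t @[t --> F] --> 0 -> f t @[t --> F] --> l.
Proof.
move=> fg g0; apply/cvgrPdist_lt => e e0.
have /cvgr0_norm_lt/(_ _ e0) := g0; apply: filterS => t.
by rewrite distrC; apply: le_lt_trans; rewrite (le_trans (fg t))// ler_norm.
Qed.

Lemma cvg_dist0 {V : normedModType R} (f : T -> V) (l : V) :
  f t @[t --> F] --> l -> `|f t - l| @[t --> F] --> 0.
Proof.
move=> fl; rewrite -(normr0 V) -(subrr l).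
by apply: cvg_norm; apply: cvgB => //; exact: cvg_cst.
Qed.

Lemma cvg_innerl f x w :
  f t @[t --> F] --> x -> inner (f t) w @[t --> F] --> inner x w.
Proof.
move=> fx; apply: (cvg_norm_le (g := fun t => `|f t - x| * `|w|)).
  by move=> t; rewrite -innerBl inner_CS.
rewrite -(mul0r `|w|); apply: cvgMr_tmp; exact: cvg_dist0.
Qed.

Lemma cvg_inner f g x y : f t @[t --> F] --> x -> g t @[t --> F] --> y ->
  inner (f t) (g t) @[t --> F] --> inner x y.
Proof.
move=> fx gy.
have fE : (fun t => inner (f t - x) (g t - y)
   + inner (f t) y + inner (g t) x - inner x y) = (fun t => inner (f t) (g t)).
  by apply/funext => t; rewrite !innerE (innerC (g t) x); ring.
have lE : 0 + inner x y + inner y x - inner x y = inner x y.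
  by rewrite (innerC y x); ring.
rewrite -lE -fE; apply: cvgB; last exact: cvg_cst.
apply: cvgD; last exact: cvg_innerl.
apply: cvgD; last exact: cvg_innerl.
apply: (cvg_norm_le (g := fun t => `|f t - x| * `|g t - y|)).
  by move=> t; rewrite subr0 inner_CS.
by rewrite -(mul0r 0); apply: cvgM; exact: cvg_dist0.
Qed.

(** Pairing of a weakly with a strongly convergent family. Boundedness is assumed because weak
    convergence along a general filter does not imply it. *)
Lemma weak_cvg_inner f g x y (M : R) : (forall t, `|f t| <= M) ->
  (forall w, inner (f t) w @[t --> F] --> inner x w) ->
  g t @[t --> F] --> y -> inner (f t) (g t) @[t --> F] --> inner x y.
Proof.
move=> fM fx gy.
have -> : (fun t => inner (f t) (g t))
    = (fun t => inner (f t) y + inner (f t) (g t - y)).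
  by apply/funext => t; rewrite -innerDr addrC subrK.
rewrite -(addr0 (inner x y)); apply: cvgD => //.
apply: (cvg_norm_le (g := fun t => M * `|g t - y|)).
  by move=> t; rewrite subr0 (le_trans (inner_CS _ _))// ler_wpM2r.
by rewrite -(mulr0 M); apply: cvgMl_tmp; exact: cvg_dist0.
Qed.

Lemma cvg_posop a M (U : K -> K) f x : 0 <= a -> posop a M U ->
  f t @[t --> F] --> x -> U (f t) @[t --> F] --> U x.
Proof.
move=> a0 UP fx; apply: (cvg_norm_le (g := fun t => M * `|f t - x|)).
  by move=> t; rewrite -(selfadjointB _ _ (posop_sa UP)) (posop_norm_le a0).
by rewrite -(mulr0 M); apply: cvgMl_tmp; exact: cvg_dist0.
Qed.

End InnerLimits.

(** Minimizing sequences and monotone sequences of operators both yield Cauchy estimates of this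
    shape. *)
Lemma cauchy_seq_is_cvg {R : realType} {V : completeNormedModType R}
    (x : V ^nat) (e : R ^nat) :
  (forall n k, `|x n - x k| ^+ 2 <= e n + e k) -> e n @[n --> \oo] --> 0 ->
  cvgn x.
Proof.
move=> xe e0; apply: cauchy_cvg; apply: cauchy_exP => /= d d0.
have d2 : 0 < d ^+ 2 / 2 by rewrite divr_gt0// exprn_gt0.
have [N _ hN] := (cvgr0_norm_lt _ e0 _ d2).
exists (x N); exists N => // k /= Nk.
rewrite -ball_normE /=.
have := hN N (leqnn N); have := hN k Nk; rewrite /= => h1 h2.
rewrite -ltr_sqr ?nnegrE ?(ltW d0)//; apply: le_lt_trans (xe _ _) _.
by have := ler_norm (e N); have := ler_norm (e k); lra.
Qed.

(* The strongly convex function [(x, t) |-> <Q x, x> / 2 + t] attains its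
   minimum on [E]; the conclusion is its first order optimality condition. *)
Lemma strongly_convex_min {R : realType} {K : hilbertType R} (a M : R)
    (Q : K -> K) (E : K -> R -> Prop) (m : R) :
  0 < a -> posop a M Q ->
  (forall x s y t (u : R), 0 <= u <= 1 -> E x s -> E y t ->
    E (x + u *: (y - x)) (s + u * (t - s))) ->
  (forall (x : K ^nat) (t : R ^nat) y s, (forall n, E (x n) (t n)) ->
     x n @[n --> \oo] --> y -> t n @[n --> \oo] --> s -> E y s) ->
  (exists x t, E x t) ->
  (forall x t, E x t -> m <= inner (Q x) x / 2 + t) ->
  exists x t, E x t /\ forall y s, E y s -> t <= s + inner (Q x) (y - x).
Proof.
move=> a0 QP Econv Eclosed [x0 [t0 E0]] Em.
have sQ := posop_sa QP.
have QD x y : Q (x + y) = Q x + Q y by exact: selfadjointD.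
have QN x : Q (- x) = - Q x by exact: selfadjointN.
have QZ u x : Q (u *: x) = u *: Q x by exact: selfadjointZ.
(* The gain over affine interpolation along a segment is exactly [u (1 - u) / 2] times the squared
   [Q]-length. *)
have quad x s y t u : inner (Q (x + u *: (y - x))) (x + u *: (y - x)) / 2
    + (s + u * (t - s)) = (inner (Q x) x / 2 + s)
      + u * ((inner (Q y) y / 2 + t) - (inner (Q x) x / 2 + s))
      - u * (1 - u) / 2 * inner (Q (y - x)) (y - x).
  rewrite !(QD, QZ, QN) !innerE.
  by rewrite (sQ y x) (innerC y (Q x)); field.
pose V := [set f | exists x t, E x t /\ f = inner (Q x) x / 2 + t].
have Vinf : has_inf V.
  split; first by exists (inner (Q x0) x0 / 2 + t0); exists x0, t0.
  by exists m => _ [x [t [Ext ->]]]; exact: Em.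
have infV x t : E x t -> inf V <= inner (Q x) x / 2 + t.
  by move=> Ext; apply: ge_inf; [case: Vinf|exists x, t].
have /choice[p pP] n : exists p : K * R, E p.1 p.2 /\
    inner (Q p.1) p.1 / 2 + p.2 < inf V + n.+1%:R^-1.
  have n0 : (0 : R) < n.+1%:R^-1 by rewrite invr_gt0.
  by have [_ [x [t [Ext ->]]] lt] := inf_adherent n0 Vinf; exists (x, t).
pose x n := (p n).1; pose t n := (p n).2.
have h0 : (n.+1%:R^-1 : R) @[n --> \oo] --> 0 by exact: cvg_harmonic.
have xc : cvgn x.
  (* At the midpoint [quad] gains an eighth of [<Q d, d>], with [d] the difference of the two
     points, and their values are within [1 / (n + 1)] and [1 / (k + 1)] of the infimum; hence the
     factor [4 / a]. *)
  apply: (@cauchy_seq_is_cvg _ _ _ (fun n => 4 / a * n.+1%:R^-1)).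
    move=> n k; have [En ltn] := pP n; have [Ek ltk] := pP k.
    have half : 0 <= (2^-1 : R) <= 1 by lra.
    have := infV _ _ (Econv _ _ _ _ _ half Ek En).
    rewrite quad; have := posop_ge QP ((p n).1 - (p k).1).
    move=> q1 q2; rewrite /x -mulrDr -(ler_pM2l a0).
    rewrite (_ : a * (4 / a * _) = 4 * (n.+1%:R^-1 + k.+1%:R^-1)); last first.
      by rewrite mulrA mulrCA divff ?gt_eqF// mulr1.
    by move: (n.+1%:R^-1) (k.+1%:R^-1) ltn ltk q1 q2 => i j; lra.
  by rewrite -(mulr0 (4 / a)); apply: cvgMl_tmp.
pose xs := limn x.
have xcv : x n @[n --> \oo] --> xs by [].
have qcv : inner (Q (x n)) (x n) / 2 @[n --> \oo] --> inner (Q xs) xs / 2.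
  by apply: cvgMr_tmp; apply: cvg_inner => //; exact: (cvg_posop (ltW a0) QP).
have fcv : inner (Q (x n)) (x n) / 2 + t n @[n --> \oo] --> inf V.
  apply: (cvg_norm_le _ h0) => n; have [En ltn] := pP n.
  rewrite ger0_norm ?subr_ge0 ?infV// lerBlDl.
  exact: ltW.
(* The heights [t n] converge because the values and their quadratic parts do; closedness of [E]
   then makes the infimum attained. *)
pose ts := inf V - inner (Q xs) xs / 2.
have tcv : t n @[n --> \oo] --> ts.
  rewrite [t](_ : _ = fun n => (inner (Q (x n)) (x n) / 2 + t n)
    - inner (Q (x n)) (x n) / 2); first exact: cvgB.
  by apply/funext => n; ring.
have Es : E xs ts by apply: Eclosed xcv tcv => n; have [] := pP n.
exists xs, ts; split=> // y s Eys.
rewrite -subr_ge0 leNgt; apply/negP.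
set d := s + _ - _ => d0.
set D := inner (Q (y - xs)) (y - xs).
have D0 : 0 <= D by exact: posop_ge0 (ltW a0) QP _.
(* [d] is the slope towards [(y, s)]. Were it negative, a step [u] with [u (D + 1) <= - d] would go
   below the infimum, since then [d + u D / 2 < 0]. *)
pose u := Num.min 1 (- d / (D + 1)).
have u0 : 0 < u by rewrite lt_min ltr01 divr_gt0//; lra.
have u1 : u <= 1 by rewrite ge_min lexx.
have uD : u * (D + 1) <= - d.
  by rewrite -ler_pdivlMr ?ge_min ?lexx ?orbT//; lra.
have uu : 0 <= u <= 1 by rewrite (ltW u0) u1.
have := infV _ _ (Econv _ _ _ _ _ uu Es Eys).
rewrite quad -/D.
have -> : inner (Q y) y = inner (Q xs) xs + 2 * inner (Q xs) (y - xs) + D.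
  rewrite /D QD QN !innerE (sQ y xs) (innerC y).
  by ring.
rewrite (_ : inner (Q xs) xs / 2 + ts = inf V); last by rewrite /ts; ring.
have dE : s - ts + inner (Q xs) (y - xs) = d by rewrite /d; ring.
move=> h.
have : 0 <= u * (d + u * D / 2).
  by move: h; rewrite -dE /ts; lra.
rewrite pmulr_rge0//; lra.
Qed.

(** * Riesz representation, inverse metrics and adjoints *)

Section Riesz.
Context {R : realType} {K : hilbertType R}.

(** The function [<Q x, x> / 2 - l x] is minimized, with the graph of [- l] as [E]; optimality
    against both [x + w] and [x - w] becomes an equality. Completing the square in
    [a |x|^2 / 2 - c |x|] gives the lower bound. *)
Lemma posop_Riesz (a M : R) (Q : K -> K) (l : K -> R) (c : R) :
  0 < a -> posop a M Q -> (forall x y, l (x + y) = l x + l y) ->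
  (forall (t : R) x, l (t *: x) = t * l x) -> (forall x, `|l x| <= c * `|x|) ->
  exists x, forall w, inner (Q x) w = l w.
Proof.
move=> a0 QP lD lZ lc.
have lB x y : l (x - y) = l x - l y by rewrite lD -scaleN1r lZ mulN1r.
have l0 : l 0 = 0 by rewrite -(subrr 0) lB subrr.
have [|||x t ->|x [_ [-> xmin]]] :=
    @strongly_convex_min _ _ a M Q (fun x t => t = - l x) (- (c ^+ 2 / (2 * a)))
    a0 QP.
- by move=> x s y t u _ -> ->; rewrite lD lZ lB; ring.
- move=> x t y s tE xy ts; apply: (cvg_unique (@norm_hausdorff _ R^o) ts).
  have -> : t = (fun n => - l (x n)) by apply/funext => n; exact: tE.
  apply: cvgN; apply: (cvg_norm_le (g := fun n => c * `|x n - y|)).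
    by move=> n; rewrite -lB.
  by rewrite -(mulr0 c); apply: cvgMl_tmp; exact: cvg_dist0.
- by exists 0, 0; rewrite l0 oppr0.
- have := posop_ge QP x; have := lc x; have := ler_norm (l x).
  move=> h1 h2 h3.
  have : 0 <= (a * `|x| - c) ^+ 2 / (2 * a).
    by rewrite divr_ge0 ?sqr_ge0// mulr_ge0// ltW.
  have -> : (a * `|x| - c) ^+ 2 / (2 * a) =
     a * `|x| ^+ 2 / 2 - c * `|x| + c ^+ 2 / (2 * a).
    by field; rewrite gt_eqF.
  by lra.
exists x => w.
have := xmin (x + w) _ erefl; have := xmin (x - w) _ erefl.
rewrite !(addrAC x _ (- x)) subrr !add0r innerNr lB lD; lra.
Qed.

(** Representing the functionals [<x, .>] makes [U] surjective, and coercivity makes it injective.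
    The lower bound on [S] is [posop_sqr_le] at [S x]; the upper one follows from
    [a |S x| <= |x|]. *)
Lemma posop_inverse (a M : R) (U : K -> K) : 0 < a -> 0 < M -> posop a M U ->
  exists S, [/\ posop M^-1 a^-1 S, cancel S U & cancel U S].
Proof.
move=> a0 M0 UP; have sU := posop_sa UP.
have /choice[S SP] x : exists s, U s = x.
  have [s sP] := @posop_Riesz a M U (inner x) `|x| a0 UP (innerDr x)
    (fun t => innerZr t x) (inner_CS x).
  by exists s; apply: inner_eqP.
have US : cancel U S.
  move=> x; apply/eqP; rewrite -subr_eq0 -normr_eq0 -sqrf_eq0.
  have := posop_ge UP (S (U x) - x).
  rewrite selfadjointB// SP subrr inner0l pmulr_rle0// => h.
  by rewrite eq_le h exprn_ge0.
exists S; split=> //; split=> [x y|x].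
  by rewrite -{2}(SP x) sU SP.
apply/andP; split.
  by have := posop_sqr_le (ltW a0) UP (S x); rewrite SP innerC ler_pdivrMl.
rewrite ler_pdivlMl//.
have := posop_ge UP (S x); rewrite SP innerC => h.
have [Sx0|Sx0] := eqVneq (S x) 0.
  by rewrite Sx0 inner0l mulr0 exprn_ge0.
have Sp : 0 < `|S x| by rewrite normr_gt0.
have := le_trans h (ler_inner _ _); rewrite expr2 mulrCA ler_pM2l// => h2.
apply: le_trans (ler_wpM2l (ltW a0) (ler_inner _ _)) _.
by rewrite mulrA expr2 ler_wpM2r.
Qed.

Lemma adjointP {G : hilbertType R} (L : {linear K -> G}) (x : K) (y : G) :
  bounded_op L -> inner (L x) y = inner x (adjoint L y).
Proof.
move=> [c Lc]; rewrite /adjoint; set W := [set _ | _].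
suff : W (xget 0 W) by move=> /(_ x).
have [| | |w wP] := @posop_Riesz 1 1 id (fun x => inner (L x) y) (c * `|y|)
  ltr01 posop_id.
- by move=> u w; rewrite linearD innerDl.
- by move=> t u; rewrite linearZ innerZl.
- move=> u; rewrite mulrAC (le_trans (inner_CS _ _))//.
  by rewrite ler_wpM2r.
apply: (@xgetPex _ _ W); exists w => u; rewrite (innerC u); exact/esym/wP.
Qed.

Lemma opnorm_ge0 {G : hilbertType R} (L : {linear K -> G}) :
  bounded_op L -> 0 <= opnorm L.
Proof.
move=> [c Lc]; apply: ub_le_sup; last first.
  by exists 0; rewrite /= ?linear0 normr0.
exists `|c| => _ [u /= u1 <-]; apply: le_trans (Lc u) _.
apply: le_trans (ler_wpM2r _ (ler_norm c)) _ => //.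
by rewrite -{2}(mulr1 `|c|) ler_wpM2l.
Qed.

Lemma opnormP {G : hilbertType R} (L : {linear K -> G}) (x : K) :
  bounded_op L -> `|L x| <= opnorm L * `|x|.
Proof.
move=> [c Lc]; have [->|x0] := eqVneq x 0; first by rewrite linear0 !normr0 mulr0.
have xp : 0 < `|x| by rewrite normr_gt0.
rewrite -ler_pdivrMr//; apply: ub_le_sup.
  exists `|c| => _ [u /= u1 <-]; apply: le_trans (Lc u) _.
  apply: le_trans (ler_wpM2r _ (ler_norm c)) _ => //.
  by rewrite -{2}(mulr1 `|c|) ler_wpM2l.
exists (`|x|^-1 *: x) => /=.
  by rewrite normrZ normfV normr_id mulVf// normr_eq0.
by rewrite linearZ normrZ normfV normr_id mulrC.
Qed.

End Riesz.

(** * Hilbert direct sums *)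

(** The dependent product under a name of its own, to which the Hilbert structure can be
    attached. *)
Definition hsum (R : realType) (I : finType) (K : I -> hilbertType R) : Type :=
  forall i, K i.

Section HilbertSum.
Context {R : realType} {I : finType} (K : I -> hilbertType R).
Implicit Types x y z : hsum K.

HB.instance Definition _ := gen_eqMixin (hsum K).
HB.instance Definition _ := gen_choiceMixin (hsum K).

Definition hsum_zero : hsum K := fun i => 0.
Definition hsum_opp x : hsum K := fun i => - x i.
Definition hsum_add x y : hsum K := fun i => x i + y i.
Definition hsum_scale (a : R) x : hsum K := fun i => a *: x i.

Lemma hsumP x y : (forall i, x i = y i) -> x = y.
Proof. exact: functional_extensionality_dep. Qed.

Lemma hsum_addA : associative hsum_add.
Proof. by move=> x y z; apply: hsumP => i; rewrite /hsum_add addrA. Qed.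
Lemma hsum_addC : commutative hsum_add.
Proof. by move=> x y; apply: hsumP => i; rewrite /hsum_add addrC. Qed.
Lemma hsum_add0 : left_id hsum_zero hsum_add.
Proof. by move=> x; apply: hsumP => i; rewrite /hsum_add add0r. Qed.
Lemma hsum_addN : left_inverse hsum_zero hsum_opp hsum_add.
Proof. by move=> x; apply: hsumP => i; rewrite /hsum_add addNr. Qed.

HB.instance Definition _ := GRing.isZmodule.Build (hsum K)
  hsum_addA hsum_addC hsum_add0 hsum_addN.

Lemma hsum_scaleA a b x : hsum_scale a (hsum_scale b x) = hsum_scale (a * b) x.
Proof. by apply: hsumP => i; rewrite /hsum_scale scalerA. Qed.
Lemma hsum_scale1 : left_id 1 hsum_scale.
Proof. by move=> x; apply: hsumP => i; rewrite /hsum_scale scale1r. Qed.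
Lemma hsum_scaleDr : right_distributive hsum_scale +%R.
Proof. by move=> a x y; apply: hsumP => i; rewrite /hsum_scale scalerDr. Qed.
Lemma hsum_scaleDl x : {morph hsum_scale^~ x : a b / a + b}.
Proof. by move=> a b; apply: hsumP => i; rewrite /hsum_scale scalerDl. Qed.

HB.instance Definition _ := GRing.Zmodule_isLmodule.Build R (hsum K)
  hsum_scaleA hsum_scale1 hsum_scaleDr hsum_scaleDl.

Definition hsum_inner x y : R := \sum_i inner (x i) (y i).
Definition hsum_norm x : R := Num.sqrt (hsum_inner x x).

Lemma hsum_innerC x y : hsum_inner x y = hsum_inner y x.
Proof. by apply: eq_bigr => i _; rewrite innerC. Qed.
Lemma hsum_innerDl x y z :
  hsum_inner (x + y) z = hsum_inner x z + hsum_inner y z.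
Proof. by rewrite -big_split; apply: eq_bigr => i _; exact: innerDl. Qed.
Lemma hsum_innerZl a x y : hsum_inner (a *: x) y = a * hsum_inner x y.
Proof. by rewrite big_distrr; apply: eq_bigr => i _; exact: innerZl. Qed.
Lemma hsum_innerxx x : hsum_inner x x = \sum_i `|x i| ^+ 2.
Proof. by apply: eq_bigr => i _; rewrite inner_sqr. Qed.
Lemma hsum_inner_ge0 x : 0 <= hsum_inner x x.
Proof. by rewrite hsum_innerxx sumr_ge0// => i _; rewrite exprn_ge0. Qed.
Lemma hsum_norm_sqr x : hsum_norm x ^+ 2 = hsum_inner x x.
Proof. by rewrite sqr_sqrtr// hsum_inner_ge0. Qed.

Lemma ler_hsum_norm x i : `|x i| <= hsum_norm x.
Proof.
rewrite -ler_sqr ?nnegrE ?sqrtr_ge0// hsum_norm_sqr hsum_innerxx (bigD1 i)//=.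
by rewrite lerDl sumr_ge0// => j _; rewrite exprn_ge0.
Qed.

Lemma ler_hsum_normD x y : hsum_norm (x + y) <= hsum_norm x + hsum_norm y.
Proof.
(* The Hilbert structure is still being built, so Cauchy-Schwarz is derived again from the
   discriminant. *)
have CS : hsum_inner x y <= hsum_norm x * hsum_norm y; last first.
  rewrite -ler_sqr ?nnegrE ?addr_ge0 ?sqrtr_ge0//.
  rewrite sqrrD !hsum_norm_sqr hsum_innerDl !(hsum_innerC _ (x + y)).
  by rewrite !hsum_innerDl (hsum_innerC y x); lra.
rewrite (le_trans (ler_norm _))//.
rewrite -ler_sqr ?nnegrE ?mulr_ge0 ?sqrtr_ge0// real_normK ?num_real//.
rewrite exprMn !hsum_norm_sqr.
apply: quadratic_ge0_discriminant => [|t]; first exact: hsum_inner_ge0.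
have := hsum_inner_ge0 (t *: x + y).
rewrite hsum_innerDl hsum_innerZl !(hsum_innerC _ (t *: x + y)).
rewrite !hsum_innerDl !hsum_innerZl (hsum_innerC y x).
by congr (0 <= _); ring.
Qed.

Lemma hsum_normZ a x : hsum_norm (a *: x) = `|a| * hsum_norm x.
Proof.
rewrite /hsum_norm hsum_innerZl hsum_innerC hsum_innerZl mulrA -expr2.
by rewrite sqrtrM ?sqr_ge0// sqrtr_sqr.
Qed.

Lemma hsum_norm_eq0 x : hsum_norm x = 0 -> x = 0.
Proof.
move=> x0; apply: hsumP => i; apply/eqP; rewrite -normr_eq0 eq_le normr_ge0.
by rewrite andbT -x0 ler_hsum_norm.
Qed.

HB.instance Definition _ := Lmodule_isNormed.Build R (hsum K)
  ler_hsum_normD hsum_normZ hsum_norm_eq0.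

Lemma hsum_normE x : `|x| = hsum_norm x. Proof. by []. Qed.

Lemma hsum_cvg (F : set_system (hsum K)) : ProperFilter F -> cauchy F -> cvg F.
Proof.
move=> FF Fc.
have Fi i : cvg (x i @[x --> F]).
  apply: cauchy_cvg; apply: cauchy_exP => e e0.
  have [x Fx] := (cauchyP F).1 Fc e e0.
  exists (x i); change (F [set y | ball (x i) e (y i)]).
  apply: filterS Fx => y; rewrite -!ball_normE /=; apply: le_lt_trans.
  exact: (ler_hsum_norm (x - y) i).
pose l : hsum K := fun i => lim (x i @[x --> F]).
apply/cvg_ex; exists l; apply/cvgrPdist_le => /= e e0.
(* [N] coordinates within [e / (N + 1)] give a squared distance at most [N e^2 / (N + 1)^2 <= e^2];
   the successor also covers an empty index set. *)
pose c : R := e / (#|I|.+1%:R).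
have c0 : 0 < c by rewrite divr_gt0.
have : \forall x \near F, forall i, `|l i - x i| < c.
  apply: filter_forall => i; have /cvgrPdist_lt/(_ _ c0) := Fi i; exact.
apply: filterS => x xc.
rewrite -ler_sqr ?nnegrE ?(ltW e0)// hsum_normE hsum_norm_sqr hsum_innerxx.
apply: (@le_trans _ _ (\sum_(i : I) c ^+ 2)).
  by apply: ler_sum => i _; rewrite ler_sqr ?nnegrE ?(ltW c0)// ltW// xc.
rewrite sumr_const -mulr_natr /c expr_div_n mulrAC ler_pdivrMr ?exprn_gt0//.
rewrite ler_wpM2l ?sqr_ge0// -natrX ler_nat.
by rewrite (leq_trans (leqnSn _))// -mulnn leq_pmulr.
Qed.

HB.instance Definition _ := Uniform_isComplete.Build (hsum K) hsum_cvg.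

Lemma hsum_inner_sqr x : hsum_inner x x = `|x| ^+ 2.
Proof. by rewrite hsum_normE hsum_norm_sqr. Qed.

HB.instance Definition _ := CompleteNormedModule_isHilbert.Build R (hsum K)
  hsum_innerC hsum_innerDl hsum_innerZl hsum_inner_sqr.

Lemma hsum_innerE x y : inner x y = \sum_i inner (x i) (y i).
Proof. by []. Qed.

Lemma hsum_sqr_norm x : `|x| ^+ 2 = \sum_i `|x i| ^+ 2.
Proof. by rewrite -hsum_inner_sqr hsum_innerxx. Qed.

End HilbertSum.

(** * Maximally monotone operators *)

Lemma posopW {R : realType} {K : hilbertType R} (a b M N : R) (U : K -> K) :
  b <= a -> M <= N -> posop a M U -> posop b N U.
Proof.
move=> ba MN [sU UP]; split=> // x; have /andP[h1 h2] := UP x.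
by rewrite (le_trans _ h1) ?(le_trans h2)// ler_wpM2r ?exprn_ge0.
Qed.

Lemma posop_hsum {R : realType} {I : finType} (K : I -> hilbertType R) (a M : R)
    (U : forall i, K i -> K i) : (forall i, posop a M (U i)) ->
  posop a M (fun x : hsum K => (fun i => U i (x i)) : hsum K).
Proof.
move=> UP; split=> [x y|x].
  by rewrite !hsum_innerE; apply: eq_bigr => i _; exact: posop_sa (UP i) _ _.
rewrite hsum_innerE hsum_sqr_norm !mulr_sumr; apply/andP; split.
  by apply: ler_sum => i _; exact: posop_ge (UP i) _.
by apply: ler_sum => i _; exact: posop_le (UP i) _.
Qed.

Section MaximalMonotone.
Context {R : realType} {K : hilbertType R}.
Implicit Type A : K -> set K.

(** Adding to the graph a pair that is monotonically related to all of it keeps it monotone, so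
    maximality says that every such pair already belongs to the graph. *)
Lemma max_monotoneP A : max_monotone_op A <-> monotone_op A /\
  forall x u, (forall y v, A y v -> 0 <= inner (x - y) (u - v)) -> A x u.
Proof.
split=> -[Am Amax]; split=> //.
  move=> x u xu; apply: contrapT => nAxu.
  apply: (Amax (fun y => A y `|` [set v | y = x /\ v = u])).
    move=> y1 y2 v1 v2 [A1|[-> ->]] [A2|[-> ->]].
    - exact: Am.
    - by rewrite -(opprB x) -(opprB u) innerNl innerNr opprK; exact: xu.
    - exact: xu.
    - by rewrite !subrr inner0l.
  split=> [[y v] /= Ayv|]; first by left.
  by move=> /(_ (x, u)) /=; apply: contra_not nAxu => h; apply: h; right.
move=> A' A'm [sAA' nA'A]; apply: nA'A => -[x u] /= A'xu.
by apply: Amax => y v Ayv; apply: A'm => //; exact: (sAA' (y, v)).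
Qed.

Lemma max_monotone_inv A : max_monotone_op A -> max_monotone_op (inv_op A).
Proof.
move=> /max_monotoneP[Am Amax]; apply/max_monotoneP; split.
  by move=> x y u v Aux Avy; rewrite innerC; exact: Am.
by move=> x u h; apply: Amax => y v Ayv; rewrite innerC; exact: h.
Qed.

(** Shifts absorb the data [z] and [r i] of the inclusions, and the right-hand side in Minty's
    theorem. *)
Lemma max_monotone_shift A (s t : K) :
  max_monotone_op A -> max_monotone_op (fun x => [set u | A (x + s) (u + t)]).
Proof.
move=> /max_monotoneP[Am Amax]; apply/max_monotoneP; split.
  move=> x y u v /Am /[apply].
  by rewrite !opprD !(addrACA _ s) !(addrACA _ t) !subrr !addr0.
move=> x u h; apply: Amax => y v Ayv.
have := h (y - s) (v - t); rewrite /= !subrK => /(_ Ayv).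
by rewrite !opprB !addrA !(addrAC _ s) !(addrAC _ t).
Qed.

Lemma max_monotone_nonempty A : max_monotone_op A -> exists x u, A x u.
Proof.
move=> /max_monotoneP[_ Amax]; apply: contrapT => nA; apply: (nA); exists 0, 0.
by apply: Amax => y v Ayv; case: nA; exists y, v.
Qed.

(* Minty's theorem, in the metric of [T^-1], after Simons and Zalinescu: the
   optimality condition at the minimizer [p] of the Fitzpatrick function of [A]
   plus a half squared norm says that [(- T u, - T^-1 x)], where [p = (x, u)],
   is monotonically related to [A] with enough slack to force [x = - T u]. *)
Lemma minty0 A (a M : R) (T : K -> K) : 0 < a -> 0 < M -> posop a M T ->
  max_monotone_op A -> exists x u, A x u /\ x + T u = 0.
Proof.
move=> a0 M0 TP AM; have [Am Amax] := (max_monotoneP A).1 AM.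
have [S [SP TS ST]] := posop_inverse a0 M0 TP.
have sT := posop_sa TP; have sS := posop_sa SP.
pose QQ (b : bool) := if b then S else T.
pose Q (p : hsum (fun _ : bool => K)) : hsum (fun _ : bool => K) :=
  fun b => QQ b (p b).
pose c := Num.min M^-1 a; pose d := Num.max a^-1 M.
have c0 : 0 < c by rewrite lt_min a0 invr_gt0 M0.
have QP : posop c d Q.
  apply: posop_hsum => -[]; rewrite /QQ.
    by apply: posopW SP; [rewrite ge_min lexx|rewrite le_max lexx].
  by apply: posopW TP; [rewrite ge_min lexx orbT|rewrite le_max lexx orbT].
pose pr x u : hsum (fun _ : bool => K) := fun b : bool => if b then x else u.
have prE x u y v : inner (pr x u) (pr y v) = inner x y + inner u v.
  by rewrite hsum_innerE big_bool.
(* [E] is the epigraph of the Fitzpatrick function; working with it avoids a supremum that may be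
   infinite. *)
pose E (p : hsum (fun _ : bool => K)) (t : R) := forall y v, A y v ->
  inner p (pr v y) - inner y v <= t.
(* The Fitzpatrick function dominates the pairing [<x, u>]: a smaller value off the graph would make
   [(x, u)] related to all of [A]. *)
have Ege x u t : E (pr x u) t -> inner x u <= t.
  move=> h; have [Axu|nAxu] := pselect (A x u).
    by have := h _ _ Axu; rewrite prE (innerC u); lra.
  rewrite leNgt; apply/negP => tlt; apply: nAxu; apply: Amax => y v /h.
  by rewrite prE !innerE (innerC u y); lra.
have prK p : pr (p true) (p false) = p by apply: hsumP => -[].
have Qpr x u : Q (pr x u) = pr (S x) (T u) by apply: hsumP => -[].
have [| | |p t Ept|p [t [Ept pmin]]] :=
  @strongly_convex_min _ _ c d Q E 0 c0 QP.
- move=> p s q t u /andP[u0 u1] Ep Eq y v Ayv.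
  have h1 : 0 <= u * (t - (inner q (pr v y) - inner y v)).
    by rewrite mulr_ge0// subr_ge0 Eq.
  have h2 : 0 <= (1 - u) * (s - (inner p (pr v y) - inner y v)).
    by rewrite mulr_ge0 ?subr_ge0// Ep.
  by rewrite !innerE; lra.
- move=> p t q s Ep pq ts y v Ayv.
  apply: (ler_cvg_to (a := \oo) (f := fun n => inner (p n) (pr v y) - inner y v) _ ts).
  + by apply: cvgB; [exact: cvg_innerl|exact: cvg_cst].
  + by apply: nearW => n; exact: Ep.
- have [y [v Ayv]] := max_monotone_nonempty AM.
  exists (pr y v), (inner y v) => y' v' Ayv'; have := Am _ _ _ _ Ayv Ayv'.
  by rewrite prE !innerE (innerC v); lra.
(* Half the squared norm plus [<x, u>] equals half of [<T (u + S x), u + S x>], so the minimized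
   function is nonnegative. *)
- rewrite -(prK p) in Ept *; rewrite Qpr prE; have := Ege _ _ _ Ept.
  move: (p true) (p false) => x u.
  have := posop_ge0 (ltW a0) TP (u + S x).
  rewrite selfadjointD// TS !innerE (innerC (T u) (S x)) sS ST (innerC x (S x)).
  by rewrite (innerC x u); lra.
move: p Ept pmin => p; rewrite -(prK p); move: (p true) (p false) => x u.
rewrite Qpr => Ext xmin.
(* By monotonicity a pair [(y, v)] of [A] lies in the epigraph at height [<y, v>]. Optimality tested
   there, with [<x, u> <= t], leaves the slack on the left. *)
have rel y v : A y v ->
    inner (S x + u) (x + T u) <= inner (- T u - y) (- S x - v).
  move=> Ayv; have Eyv : E (pr y v) (inner y v).
    move=> y' v' Ayv'; have := Am _ _ _ _ Ayv Ayv'.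
    by rewrite prE !innerE (innerC v); lra.
  have := xmin _ _ Eyv; rewrite innerBr !prE.
  have := Ege _ _ _ Ext.
  rewrite !innerE (innerC (T u) (S x)) (sS x (T u)) ST (innerC u (T u)).
  by rewrite (innerC y (S x)) (innerC x u); lra.
have SxE : S x + u = S (x + T u) by rewrite selfadjointD// ST.
have SxTu : 0 <= inner (S x + u) (x + T u).
  by rewrite SxE (posop_ge0 _ SP)// invr_ge0 ltW.
have AST : A (- T u) (- S x).
  by apply: Amax => y v /rel; exact: le_trans.
have xTu : x = - T u.
  apply/eqP; rewrite -subr_eq0 opprK -normr_eq0 -sqrf_eq0.
  have := rel _ _ AST; rewrite !subrr inner0l SxE => h.
  have := le_trans (posop_ge SP _) h.
  by rewrite pmulr_rle0 ?invr_gt0// => h2; rewrite eq_le h2 exprn_ge0.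
exists (- T u), (- S x); split=> //.
by rewrite xTu !(selfadjointN _ sS, selfadjointN _ sT) ST opprK addNr.
Qed.

Lemma minty A (a M : R) (T : K -> K) (w : K) : 0 < a -> 0 < M -> posop a M T ->
  max_monotone_op A -> exists x u, A x u /\ x + T u = w.
Proof.
move=> a0 M0 TP AM.
have [x [u [Axu xu]]] := minty0 a0 M0 TP (max_monotone_shift w 0 AM).
by exists (x + w), u; move: Axu; rewrite /= addr0; split=> //; rewrite addrAC xu add0r.
Qed.

(** If [(x, u)] is related to [A] and [(y, v)] in [A] has the same sum [y + v = x + u], then
    [0 <= <x - y, u - v> = - |x - y|^2], so the two pairs coincide. *)
Lemma minty_max_monotone A : monotone_op A ->
  (forall w, exists x u, A x u /\ x + u = w) -> max_monotone_op A.
Proof.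
move=> Am ran; apply/max_monotoneP; split=> // x u h.
have [y [v [Ayv yv]]] := ran (x + u).
have uv : u - v = - (x - y).
  by apply/eqP; rewrite -subr_eq0 opprK addrACA -opprD (addrC v) yv (addrC u) subrr.
have := h _ _ Ayv; rewrite uv innerNr inner_sqr oppr_ge0 => h2.
have xy : x = y.
  by apply/eqP; rewrite -subr_eq0 -normr_eq0 -sqrf_eq0 eq_le h2 exprn_ge0.
by move: uv; rewrite xy subrr oppr0 => /eqP; rewrite subr_eq0 => /eqP ->.
Qed.

End MaximalMonotone.

(** * Quasi-Fejer sequences and weak limits *)

Section SummableSequences.
Context {R : realType}.
Implicit Types a b d e V : R ^nat.

(** Summability through bounded real partial sums, so that estimates stay in the real field. *)
Definition psummable a := (forall n, 0 <= a n) /\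
  exists M, forall n, \sum_(k < n) a k <= M.

Lemma psummableP a : (forall n, 0 <= a n) ->
  (\sum_(n <oo) (a n)%:E < +oo)%E <-> psummable a.
Proof.
move=> a0; split=> [aoo|[_ [M aM]]].
  split=> //; exists (fine (\sum_(n <oo) (a n)%:E)%E) => n.
  rewrite -lee_fin fineK; last first.
    by rewrite ge0_fin_numE// nneseries_ge0// => k _ _; rewrite lee_fin.
  rewrite -sumEFin -(big_mkord xpredT (fun k => (a k)%:E)).
  by apply: nneseries_lim_ge => k _ _; rewrite lee_fin.
apply: (@le_lt_trans _ _ M%:E); last exact: ltry.
apply: lime_le.
  by apply: is_cvg_nneseries => n _ _; rewrite lee_fin.
by apply: nearW => n; rewrite sumEFin lee_fin big_mkord.
Qed.

Lemma psummable_le a b : (forall n, 0 <= a n <= b n) -> psummable b ->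
  psummable a.
Proof.
move=> ab [_ [M bM]]; split=> [n|]; first by case/andP: (ab n).
exists M => n; apply: le_trans (bM n).
by apply: ler_sum => k _; case/andP: (ab k).
Qed.

Lemma psummableD a b : psummable a -> psummable b -> psummable (a \+ b).
Proof.
move=> [a0 [M aM]] [b0 [N bN]]; split=> [n|]; first exact: addr_ge0.
by exists (M + N) => n; rewrite big_split lerD.
Qed.

Lemma psummableZ (c : R) a : 0 <= c -> psummable a ->
  psummable (fun n => c * a n).
Proof.
move=> c0 [a0 [M aM]]; split=> [n|]; first exact: mulr_ge0.
by exists (c * M) => n; rewrite -mulr_sumr ler_wpM2l.
Qed.

Lemma psummable_sum (I : finType) (a : I -> R ^nat) :
  (forall i, psummable (a i)) -> psummable (fun n => \sum_i a i n).
Proof.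
move=> aS; split=> [n|]; first by apply: sumr_ge0 => i _; case: (aS i).
have /choice[M aM] i : exists M, forall n, \sum_(k < n) a i k <= M.
  by case: (aS i).
by exists (\sum_i M i) => n; rewrite exchange_big ler_sum.
Qed.

Lemma psummable_bounded a : psummable a -> exists M, forall n, a n <= M.
Proof.
move=> [a0 [M aM]]; exists M => n; apply: le_trans (aM n.+1).
by rewrite big_ord_recr /= lerDr sumr_ge0.
Qed.

Lemma psummableM a b : psummable a -> psummable b ->
  psummable (fun n => a n * b n).
Proof.
move=> aS bS; have [M bM] := psummable_bounded bS.
have M0 : 0 <= M by apply: le_trans (bM 0); case: bS.
apply: psummable_le (psummableZ M0 aS) => n.
by rewrite mulr_ge0 ?(aS.1, bS.1)//= (mulrC M) ler_wpM2l// aS.1.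
Qed.

Lemma psummable_partial_is_cvg a : psummable a ->
  cvgn (fun n => \sum_(k < n) a k).
Proof.
move=> [a0 [M aM]]; apply: nondecreasing_is_cvgn.
  apply/nondecreasing_seqP => n; rewrite big_ord_recr /= lerDl; exact: a0.
by exists M => _ [n _ <-].
Qed.

Lemma psummable_cvg0 a : psummable a -> a n @[n --> \oo] --> 0.
Proof.
move=> aS; have /cvg_ex[l al] := psummable_partial_is_cvg aS.
rewrite -(subrr l) (_ : a = fun n => \sum_(k < n.+1) a k - \sum_(k < n) a k).
  by apply: cvgB => //; rewrite (cvg_shiftS (fun n => \sum_(k < n) a k)).
by apply/funext => n; rewrite big_ord_recr /= addrAC subrr add0r.
Qed.

Lemma prod1D_ge1 a n : (forall n, 0 <= a n) -> 1 <= \prod_(k < n) (1 + a k).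
Proof.
move=> a0; elim: n => [|n IH]; first by rewrite big_ord0.
rewrite big_ord_recr /= (le_trans IH)// ler_peMr ?lerDl//.
exact: le_trans ler01 IH.
Qed.

Lemma psummable_prod_bounded a : psummable a ->
  exists P, forall n, \prod_(k < n) (1 + a k) <= P.
Proof.
move=> [a0 [M aM]]; exists (expR M) => n.
apply: (@le_trans _ _ (expR (\sum_(k < n) a k))); last by rewrite ler_expR.
rewrite expR_sum; apply: ler_prod => k _.
by rewrite addr_ge0//= expR_ge1Dx.
Qed.

Lemma prod1D_is_cvg a : psummable a -> cvgn (fun n => \prod_(k < n) (1 + a k)).
Proof.
move=> aS; have [P aP] := psummable_prod_bounded aS; have [a0 _] := aS.
apply: nondecreasing_is_cvgn; last by exists P => _ [n _ <-].
apply/nondecreasing_seqP => n; rewrite big_ord_recr /= ler_peMr ?lerDl//.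
by rewrite (le_trans ler01)// prod1D_ge1.
Qed.

(** Dividing [V n] by the product of the [1 + a k] removes these factors: the quotient minus the
    partial sums of [d] is nonincreasing and bounded below. Telescoping bounds the sum of [e], since
    the products stay below [P]. *)
Lemma quasi_fejer V a e d : (forall n, 0 <= V n) -> (forall n, 0 <= e n) ->
  psummable a -> psummable d ->
  (forall n, V n.+1 <= (1 + a n) * V n - e n + d n) ->
  cvgn V /\ psummable e.
Proof.
move=> V0 e0 aS dS VS; have [a0 _] := aS; have [d0 [D dD]] := dS.
have [P aP] := psummable_prod_bounded aS.
pose pi n := \prod_(k < n) (1 + a k).
have pi1 n : 1 <= pi n by exact: prod1D_ge1.
have pi0 n : 0 < pi n by exact: lt_le_trans ltr01 (pi1 n).
have P0 : 0 < P by exact: lt_le_trans (pi0 0) (aP 0).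
pose W n := V n / pi n.
have W0 n : 0 <= W n by rewrite divr_ge0// ltW.
have WS n : W n.+1 + e n / P <= W n + d n.
  have h1 : e n / P <= e n / pi n.+1.
    by rewrite ler_wpM2l// lef_pV2 ?posrE//; exact: aP.
  have h2 : d n / pi n.+1 <= d n by rewrite ler_pdivrMr// ler_peMr.
  have h3 : (1 + a n) * V n / pi n.+1 = W n.
    rewrite /W /pi big_ord_recr /= -/(pi n) mulrC.
    field; rewrite !gt_eqF//=; last by rewrite ltr_wpDr.
  have h4 : W n.+1 <= ((1 + a n) * V n - e n + d n) / pi n.+1.
    by rewrite ler_pM2r ?invr_gt0.
  rewrite [leRHS](_ : _ = W n - e n / pi n.+1 + d n / pi n.+1) in h4.
    by lra.
  by rewrite -h3; ring.
have eP0 n : 0 <= e n / P by rewrite divr_ge0// ltW.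
split.
  have Zc : cvgn (fun n => W n - \sum_(k < n) d k).
    apply: nonincreasing_is_cvgn.
      apply/nonincreasing_seqP => n; rewrite big_ord_recr /=.
      by have := WS n; have := eP0 n; lra.
    by exists (- D) => _ [n _ <-]; have := W0 n; have := dD n; lra.
  rewrite (_ : V = (fun n => (W n - \sum_(k < n) d k) + \sum_(k < n) d k) \* pi).
    apply: is_cvgM; last exact: prod1D_is_cvg.
    by apply: is_cvgD => //; exact: psummable_partial_is_cvg.
  by apply/funext => n /=; rewrite subrK /W divfK// gt_eqF.
split=> //; exists (P * (W 0 + D)) => n.
rewrite -ler_pdivrMl// mulrC mulr_suml.
have : \sum_(k < n) e k / P <= W 0 - W n + \sum_(k < n) d k.
  elim: n => [|n IH]; first by rewrite !big_ord0; lra.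
  by rewrite !big_ord_recr /=; have := WS n; lra.
by have := W0 n; have := dD n; lra.
Qed.

End SummableSequences.

(** * Weak limits along ultrafilters *)

Section WeakConvergence.
Context {R : realType} {K : hilbertType R}.

(** Compactness of the segment gives a cluster point, and an ultrafilter converges to each of its
    cluster points. *)
Lemma ultra_bounded_cvg {T : Type} (F : set_system T) (f : T -> R) (M : R) :
  UltraFilter F -> (forall t, `|f t| <= M) -> cvg (f t @[t --> F]).
Proof.
move=> FU fM; have PF := @ultra_proper _ _ FU.
have [|c [_ Fc]] := @segment_compact R (- M) M (f @ F) _.
  change (F (f @^-1` `[- M, M])); apply: filterE => t /=.
  by rewrite in_itv /= -ler_norml.
apply/cvg_ex; exists c => A Ac.
have [//|FA] := in_ultra_setVsetC (f @^-1` A) FU.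
by have [r [/= nAr Ar]] := Fc (~` A) A FA Ac.
Qed.

(** The limits of the [<x n, w>] form a linear functional of [w] bounded by [M], which Riesz
    represents. This plays the role of weak compactness. *)
Lemma weak_cvg_ultra (F : set_system nat) (x : K ^nat) (M : R) :
  UltraFilter F -> (forall n, `|x n| <= M) ->
  exists l : K, forall w, inner (x n) w @[n --> F] --> inner l w.
Proof.
move=> FU xM; have PF := @ultra_proper _ _ FU.
pose f w := lim (inner (x n) w @[n --> F]).
have M0 : 0 <= M by exact: le_trans (xM 0).
have xw w n : `|inner (x n) w| <= M * `|w|.
  by rewrite (le_trans (inner_CS _ _))// ler_wpM2r.
have fc w : inner (x n) w @[n --> F] --> f w.
  exact: ultra_bounded_cvg FU (xw w).
have [| | |l lP] := @posop_Riesz R K 1 1 id f M ltr01 posop_id.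
- move=> v w; apply: (cvg_unique (@norm_hausdorff _ R^o) (fc _)).
  rewrite (_ : (fun n => _) = fun n => inner (x n) v + inner (x n) w).
    exact: cvgD.
  by apply/funext => n; rewrite innerDr.
- move=> t w; apply: (cvg_unique (@norm_hausdorff _ R^o) (fc _)).
  rewrite (_ : (fun n => _) = fun n => t * inner (x n) w).
    exact: cvgMl_tmp.
  by apply/funext => n; rewrite innerZr.
- move=> w; have h : `|inner (x n) w| @[n --> F] --> `|f w| by exact: cvg_norm.
  apply: (ler_cvg_to h (cvg_cst (M * `|w|))).
  by apply: nearW => n; exact: xw.
by exists l => w; rewrite lP.
Qed.

(** If [<x n, w>] left a neighborhood of [<l, w>] infinitely often, some ultrafilter finer than
    [\oo] would contain the set of these indices, yet the weak limit along it is [l]. *)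
Lemma weak_cvg_of_ultra (x : K ^nat) (M : R) (l : K) :
  (forall n, `|x n| <= M) ->
  (forall (F : set_system nat) (l' : K), UltraFilter F -> \oo `<=` F ->
     (forall w, inner (x n) w @[n --> F] --> inner l' w) -> l' = l) ->
  weak_cvg x l.
Proof.
move=> xM h w A Al; apply: contrapT => nA.
pose D := ~` ((fun n => inner (x n) w) @^-1` A).
have PD : ProperFilter (within D \oo).
  apply: Build_ProperFilter => D0; apply: nA; rewrite /within /= in D0.
  by apply: filterS D0 => n /= Dn; apply: contrapT => /Dn.
have [F [FU DF]] := ultraFilterLemma PD.
have PF := @ultra_proper _ _ FU.
have ooF : \oo `<=` F.
  by move=> B oB; apply: DF; apply: filterS oB.
have [l' l'P] := weak_cvg_ultra FU xM.
have ll := h F l' FU ooF l'P; rewrite ll in l'P.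
have FD : F D by apply: DF; apply: (@filterE _ \oo _ (fun n => D n -> D n)).
have FA : F ((fun n => inner (x n) w) @^-1` A) := l'P w A Al.
have [n [Dn An]] := @filter_ex _ _ PF _ (filterI FD FA).
exact: Dn An.
Qed.

End WeakConvergence.

(** * The forward-backward-forward iteration *)

Section Metrics.
Context {R : realType} {K : hilbertType R}.
Implicit Types (U S T : K -> K) (x y z : K).

Lemma inner_quadD S x y : selfadjoint S -> inner (S (x + y)) (x + y) =
  inner (S x) x + 2 * inner (S x) y + inner (S y) y.
Proof.
by move=> sS; rewrite selfadjointD// !innerE (sS y x) (innerC y); ring.
Qed.

Lemma inner_quadN S x : selfadjoint S -> inner (S (- x)) (- x) = inner (S x) x.
Proof. by move=> sS; rewrite selfadjointN// !innerE opprK. Qed.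

(** Cauchy-Schwarz in [U] between [S x] and [T x] gives [<T x, x>^2 <= <S x, x> <U (T x), T x>],
    whose last factor is at most [c <T x, x>]. *)
Lemma inverse_antitone (a b M N c : R) U S T V : 0 < a -> 0 < b ->
  posop a M U -> posop b N V ->
  selfadjoint S -> selfadjoint T -> cancel S U -> cancel T V -> 0 <= c ->
  (forall x, inner (U x) x <= c * inner (V x) x) ->
  forall x, inner (T x) x <= c * inner (S x) x.
Proof.
move=> a0 b0 UP VP sS sT SK TK c0 UV x.
have Tx : inner (V (T x)) (T x) = inner (T x) x by rewrite TK innerC.
have Sx : inner (U (S x)) (S x) = inner (S x) x by rewrite SK innerC.
have T0 : 0 <= inner (T x) x by rewrite -Tx (posop_ge0 (ltW b0) VP).
have S0 : 0 <= inner (S x) x by rewrite -Sx (posop_ge0 (ltW a0) UP).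
have [->|Tn0] := eqVneq (inner (T x) x) 0; first exact: mulr_ge0.
have Tp : 0 < inner (T x) x by rewrite lt_neqAle eq_sym Tn0.
rewrite -(ler_pM2r Tp) -expr2.
have := posop_CS (ltW a0) UP (S x) (T x); rewrite Sx SK (innerC x) => h.
apply: le_trans h _; rewrite -mulrA mulrCA ler_wpM2l//.
by rewrite -Tx UV.
Qed.

(* Dividing by the product makes the sequence of operators nonincreasing. *)
Lemma scaled_metric_is_cvg (a M : R) (S : nat -> K -> K) (k : R ^nat) x :
  0 <= a -> (forall n, posop a M (S n)) -> psummable k ->
  (forall n x, inner (S n.+1 x) x <= (1 + k n) * inner (S n x) x) ->
  cvgn (fun n => (\prod_(i < n) (1 + k i))^-1 *: S n x).
Proof.
move=> a0 SP kS Sk; have [k0 _] := kS.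
pose pi n := \prod_(i < n) (1 + k i).
have pi1 n : 1 <= pi n by exact: prod1D_ge1.
have pi0 n : 0 < pi n by exact: lt_le_trans ltr01 (pi1 n).
pose T n x := (pi n)^-1 *: S n x.
have sT n : selfadjoint (T n).
  by move=> u v; rewrite /T innerZl innerZr (posop_sa (SP n)).
have T0 n u : 0 <= inner (T n u) u.
  by rewrite /T innerZl mulr_ge0 ?invr_ge0 ?(ltW (pi0 n)) ?(posop_ge0 a0 (SP n)).
have TS n u : inner (T n.+1 u) u <= inner (T n u) u.
  rewrite /T !innerZl ler_pdivrMl// mulrA /pi big_ord_recr /= -/(pi n).
  by rewrite (mulrC (pi n)) mulfK ?gt_eqF.
have Tmono u m n : (m <= n)%N -> inner (T n u) u <= inner (T m u) u.
  by move=> mn; apply: (@nonincreasing_seqP _ _ (fun n => inner (T n u) u)).1.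
have TM n u : inner (T n u) u <= M * `|u| ^+ 2.
  apply: le_trans (Tmono u 0 n (leq0n n)) _.
  by rewrite /T /pi big_ord0 invr1 scale1r (posop_le (SP 0)).
have tc : cvgn (fun n => inner (T n x) x).
  apply: nonincreasing_is_cvgn; last by exists 0 => _ [n _ <-].
  by move=> m n; exact: Tmono.
have /cvg_ex[t tl] := tc.
(* The difference of two terms is semidefinite and bounded by [M], so [psd_sqr_le] turns convergence
   of the quadratic forms into strong convergence. *)
have key m n : (m <= n)%N -> `|T m x - T n x| ^+ 2
    <= `|M| * `|inner (T m x) x - t| + `|M| * `|inner (T n x) x - t|.
  move=> mn.
  pose D u := T m u - T n u.
  have := @psd_sqr_le _ _ M D _ _ _ x; rewrite -/(D x) => h.
  have {}h : `|D x| ^+ 2 <= M * inner (D x) x.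
    apply: h => [u v|u|u]; rewrite /D.
    - by rewrite innerBl innerBr !sT.
    - by rewrite innerBl subr_ge0 Tmono.
    - by rewrite innerBl; have := T0 n u; have := TM m u; lra.
  apply: le_trans h _; apply: le_trans (ler_norm _) _.
  rewrite normrM -mulrDr ler_wpM2l// /D innerBl.
  rewrite (_ : _ - _ = (inner (T m x) x - t) - (inner (T n x) x - t)).
    exact: ler_normB.
  by ring.
apply: (@cauchy_seq_is_cvg _ _ _ (fun n => `|M| * `|inner (T n x) x - t|)).
  move=> m n; have [mn|/ltnW nm] := leqP m n; first exact: key.
  by rewrite distrC [leRHS]addrC; exact: key.
by rewrite -(mulr0 `|M|); apply: cvgMl_tmp; exact: cvg_dist0.
Qed.

(* [2 <S x, e> <= 2 |S x| |e|] and [2 |x| <= |x| ^+ 2 + 1]. *)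
Lemma posop_quad_perturb (a M c : R) S x e : 0 < a -> posop a M S ->
  0 <= M -> `|e| <= c -> inner (S (x + e)) (x + e) <=
    (1 + M / a * c) * inner (S x) x + M * (c + c ^+ 2).
Proof.
move=> a0 SP M0 ec; rewrite (inner_quadD _ _ (posop_sa SP)).
have c0 : 0 <= c by exact: le_trans ec.
have h1 : inner (S x) e <= M * `|x| * c.
  apply: le_trans (ler_inner _ _) _; apply: ler_pM => //.
  exact: posop_norm_le (ltW a0) SP _.
have h2 : inner (S e) e <= M * c ^+ 2.
  apply: le_trans (posop_le SP e) _; rewrite ler_wpM2l// ler_sqr ?nnegrE//.
have h3 : `|x| ^+ 2 <= inner (S x) x / a.
  by rewrite ler_pdivlMr// mulrC; exact: posop_ge SP _.
have h4 : 0 <= M * c * (`|x| - 1) ^+ 2.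
  by apply: mulr_ge0; [exact: mulr_ge0|exact: sqr_ge0].
have h5 : M * c * `|x| ^+ 2 <= M * c * (inner (S x) x / a).
  by rewrite ler_wpM2l// mulr_ge0.
rewrite [leRHS](_ : _ = inner (S x) x + M * c * (inner (S x) x / a)
  + M * c + M * c ^+ 2); last by ring.
by lra.
Qed.

End Metrics.

(** * A single step: descent and stability under errors *)

Section ForwardBackwardForward.
Context {R : realType} {K : hilbertType R}.
Variables (A : K -> set K) (D : K -> K) (beta : R).
Hypothesis A_mono : monotone_op A.
Hypothesis D_mono : forall x y, 0 <= inner (x - y) (D x - D y).
Hypothesis D_lip : forall x y, `|D x - D y| <= beta * `|x - y|.

Lemma fbf_step (a mu g : R) (U S : K -> K) (x w z p e x' : K) :
  0 < a -> 0 < mu -> 0 < g -> posop a mu U -> posop mu^-1 a^-1 S ->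
  cancel U S ->
  10 * (g * mu * beta) ^+ 2 <= 1 -> A z (- D z) -> A p e ->
  p + g *: U e = x - g *: U (D w) ->
  x' = p + g *: U (D w - D p) ->
  inner (S (x' - z)) (x' - z) + inner (S (x' - p)) (x' - p) <=
  inner (S (x - z)) (x - z) + inner (S (x - w)) (x - w)
  - 3 / 5 * (inner (S (x - p)) (x - p) + inner (S (x - w)) (x - w)).
Proof.
move=> a0 mu0 g0 UP SP US gle Az Ap pE x'E.
have sS := posop_sa SP; have sU := posop_sa UP.
(* [S (x - x')] is [g] times [e + D p], a value of [A + D] at [p]; it is compared with the value [0]
   at [z]. *)
have mono : 0 <= inner (S (x - x')) (p - z).
  have -> : x - x' = g *: U (e + D p).
    have {1}-> : x = p + g *: U e + g *: U (D w) by rewrite pE subrK.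
    rewrite x'E (selfadjointB (D w) _ sU) (selfadjointD e _ sU).
    by apply: inner_eqP => v; rewrite !innerE; ring.
  rewrite selfadjointZ// US innerZl pmulr_rge0// innerC.
  have := A_mono Ap Az; have := D_mono p z; rewrite !innerE; lra.
have quad (u v : K) : inner (S (u - v)) (u - v) =
    inner (S u) u - 2 * inner (S u) v + inner (S v) v.
  by rewrite inner_quadD// inner_quadN// innerNr; ring.
have three : inner (S (x' - z)) (x' - z) = inner (S (x - z)) (x - z)
    - inner (S (x - p)) (x - p) + inner (S (x' - p)) (x' - p)
    - 2 * inner (S (x - x')) (p - z).
  have -> : x' - z = (x - z) - (x - x').
    by apply: inner_eqP => v; rewrite !innerE; ring.
  have -> : x - p = (x - z) - (p - z).
    by apply: inner_eqP => v; rewrite !innerE; ring.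
  have -> : x' - p = (x - z) - (p - z) - (x - x').
    by apply: inner_eqP => v; rewrite !innerE; ring.
  move: (x - z) (x - x') (p - z) => u v t.
  rewrite !quad (selfadjointB _ _ sS) innerBl (sS t v) (innerC t); ring.
(* Since [S (g U v) = g v], the left side is [g^2 <U v, v>] with [v := D w - D p], at most
   [(g mu beta)^2 <S (w - p), w - p>]. *)
have back : inner (S (x' - p)) (x' - p) <=
    10^-1 * inner (S (w - p)) (w - p).
  have -> : x' - p = g *: U (D w - D p) by rewrite x'E addrC addKr.
  rewrite selfadjointZ// US innerZl innerZr innerC mulrA -expr2.
  apply: (@le_trans _ _ (g ^+ 2 * (mu * (beta * `|w - p|) ^+ 2))).
    rewrite ler_wpM2l ?sqr_ge0//; apply: le_trans (posop_le UP _) _.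
    by rewrite ler_wpM2l ?(ltW mu0)// ler_sqr ?nnegrE// (le_trans _ (D_lip w p)).
  have := posop_ge SP (w - p); rewrite ler_pdivrMl// => h.
  have -> : g ^+ 2 * (mu * (beta * `|w - p|) ^+ 2) =
    (g * mu * beta) ^+ 2 * (`|w - p| ^+ 2 / mu) by field; rewrite gt_eqF.
  apply: ler_pM; [exact: sqr_ge0|by rewrite divr_ge0// ltW|by lra|].
  by rewrite ler_pdivrMr// mulrC.
have par : inner (S (w - p)) (w - p) <=
    2 * inner (S (x - p)) (x - p) + 2 * inner (S (x - w)) (x - w).
  have -> : w - p = (x - p) - (x - w).
    by apply: inner_eqP => v; rewrite !innerE; ring.
  have := posop_ge0 _ SP ((x - p) + (x - w)).
  by rewrite invr_ge0 quad inner_quadD// => /(_ (ltW mu0)); lra.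
(* The term bounded by [back] enters twice, through [three] and on the left, which costs
   [2 * 1/10 * 2 = 2/5] of each gap. The gap in [p] keeps [1 - 2/5 = 3/5], and for the gap in [w]
   one has [2/5 = 1 - 3/5]. *)
lra.
Qed.


(** The error [a] moves the resolvent point by at most [lam mu |a|], and [b] is added to it; the
    second forward step passes these and [c] through [D] and [g U]. A single constant [C] serves
    both bounds. *)
Lemma fbf_perturbation (al mu g lam : R) (U S : K -> K)
    (x w p e y s u p1 q1 x1 a b c : K) :
  0 <= beta -> 0 < al -> 0 < mu -> 0 < g -> g <= lam -> posop al mu U ->
  posop mu^-1 al^-1 S -> cancel U S -> A p e ->
  p + g *: U e = x - g *: U (D w) ->
  y = x - g *: U (D w + a) -> A s u -> s + g *: U u = y -> p1 = s + b ->
  q1 = p1 - g *: U (D p1 + c) -> x1 = x - y + q1 ->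
  let C := (1 + lam * mu) * (1 + lam * mu * beta) + lam * mu in
  `|p1 - p| <= C * (`|a| + `|b| + `|c|) /\
  `|x1 - (p + g *: U (D w - D p))| <= C * (`|a| + `|b| + `|c|).
Proof.
move=> be0 al0 mu0 g0 gl UP SP US Ape pE yE Asu sE p1E q1E x1E C.
have sS := posop_sa SP; have sU := posop_sa UP.
have lm0 : 0 <= lam * mu by rewrite mulr_ge0 ?ltW// (lt_le_trans g0).
have Unorm v : `|g *: U v| <= lam * mu * `|v|.
  rewrite normrZ gtr0_norm// -mulrA ler_pM ?(ltW g0)//.
  exact: posop_norm_le (ltW al0) UP _.
(* The two resolvent equations give [g (u - e) = - S (s - p) - g a]; monotonicity then bounds
   [<S (s - p), s - p>] by [g |a| |s - p|]. *)
have sp : `|s - p| <= lam * mu * `|a|.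
  have Ud : g *: U (u - e) = - (s - p) - g *: U a.
    rewrite (selfadjointB _ _ sU); apply: inner_eqP => v.
    have := congr1 (inner^~ v) pE; have := congr1 (inner^~ v) sE.
    by rewrite yE (selfadjointD _ _ sU) !innerE; lra.
  have h : g *: (u - e) = - S (s - p) - g *: a.
    rewrite -[LHS]US (selfadjointZ _ _ sU) Ud [LHS](selfadjointD _ _ sS).
    by rewrite !(selfadjointN _ sS) (selfadjointZ _ _ sS) US.
  have := A_mono Asu Ape; rewrite -(pmulr_rge0 _ g0) -innerZr h.
  rewrite innerBr innerNr (innerC _ (S _)) => h2.
  have := posop_ge SP (s - p); rewrite ler_pdivrMl// => h3.
  have [->|d0] := eqVneq (s - p) 0; first by rewrite normr0 mulr_ge0.
  have dp : 0 < `|s - p| by rewrite normr_gt0.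
  rewrite -(ler_pM2r dp) -expr2; apply: le_trans h3 _.
  have h4 : inner (S (s - p)) (s - p) <= g * `|a| * `|s - p|.
    apply: (@le_trans _ _ (g * `|inner (s - p) a|)).
      have := ler_norm (- inner (s - p) a); rewrite normrN.
      by rewrite -(ler_pM2l g0); move: h2; rewrite innerZr; lra.
    by rewrite -mulrA ler_pM2l// mulrC inner_CS.
  apply: (@le_trans _ _ (mu * (g * `|a| * `|s - p|))).
    by rewrite ler_pM2l.
  rewrite !mulrA ler_wpM2r// ler_wpM2r// mulrC ler_wpM2r// ltW//.
have [a0 b0 c0] : [/\ 0 <= `|a|, 0 <= `|b| & 0 <= `|c|] by [].
have lmb0 : 0 <= lam * mu * beta by exact: mulr_ge0.
have pp : `|p1 - p| <= (1 + lam * mu) * (`|a| + `|b| + `|c|).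
  rewrite p1E addrAC; apply: le_trans (ler_normD _ _) _.
  have : 0 <= lam * mu * (`|b| + `|c|) by rewrite mulr_ge0// addr_ge0.
  by lra.
split.
  apply: le_trans pp _; rewrite ler_wpM2r ?addr_ge0// /C.
  have := mulr_ge0 lm0 lmb0; lra.
have -> : x1 - (p + g *: U (D w - D p)) =
    (p1 - p) + g *: U (D p - D p1 + (a - c)).
  rewrite x1E q1E yE !(selfadjointD _ _ sU) !(selfadjointN _ sU).
  by apply: inner_eqP => v; rewrite !innerE; ring.
apply: le_trans (ler_normD _ _) _.
apply: le_trans (lerD pp (Unorm _)) _.
have h : `|D p - D p1 + (a - c)| <=
    beta * ((1 + lam * mu) * (`|a| + `|b| + `|c|)) + (`|a| + `|c|).
  apply: le_trans (ler_normD _ _) _; apply: lerD; last exact: ler_normB.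
  by apply: le_trans (D_lip _ _) _; rewrite ler_wpM2l// distrC.
have := ler_wpM2l lm0 h; have := mulr_ge0 lm0 b0; rewrite /C; lra.
Qed.

End ForwardBackwardForward.

Lemma sqr_normD_le {R : realType} {K : hilbertType R} (x y : K) :
  `|x + y| ^+ 2 <= 2 * `|x| ^+ 2 + 2 * `|y| ^+ 2.
Proof.
have : 0 <= `|x - y| ^+ 2 by rewrite exprn_ge0.
by rewrite sqr_normB sqr_normD; lra.
Qed.

Lemma psummable_sqr_norm_cvg0 {R : realType} {V : normedModType R} (x : V ^nat) :
  psummable (fun n => `|x n| ^+ 2) -> x n @[n --> \oo] --> 0.
Proof.
move=> /psummable_cvg0 x0; apply/cvgrPdist_lt => e e0.
have e2 : 0 < e ^+ 2 by rewrite exprn_gt0.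
have /cvgr0_norm_lt/(_ _ e2) := x0; apply: filterS => n /=.
by rewrite ger0_norm ?exprn_ge0// sub0r normrN ltr_sqr ?nnegrE// ltW.
Qed.

(** * The whole sequence: summable gaps, boundedness, weak limits *)

Section FbfSequence.
Context {R : realType} {K : hilbertType R}.
Variables (A : K -> set K) (D : K -> K) (beta : R).
Hypothesis A_max : max_monotone_op A.
Hypothesis D_mono : forall x y, 0 <= inner (x - y) (D x - D y).
Hypothesis D_lip : forall x y, `|D x - D y| <= beta * `|x - y|.
Hypothesis beta0 : 0 < beta.
Variables (al mu lam gmin : R) (U : nat -> K -> K) (eta gam : R ^nat).
Hypotheses (al0 : 0 < al) (mu0 : 0 < mu) (gmin0 : 0 < gmin).
Hypothesis UP : forall n, posop al mu (U n).
Hypothesis eta_sum : psummable eta.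
Hypothesis U_mono : forall n x,
  inner (U n x) x <= (1 + eta n) * inner (U n.+1 x) x.
Hypothesis gam_itv : forall n, gmin <= gam n <= lam.
Hypothesis lam_le : 10 * (lam * mu * beta) ^+ 2 <= 1.
Variables (x y p q a b c : K ^nat) (pm1 : K).
Hypothesis a_sum : psummable (fun n => `|a n|).
Hypothesis b_sum : psummable (fun n => `|b n|).
Hypothesis c_sum : psummable (fun n => `|c n|).
Let w n := prev_term pm1 p n.
Hypothesis yE : forall n, y n = x n - gam n *: U n (D (w n) + a n).
Hypothesis pE : forall n, exists s u,
  [/\ A s u, s + gam n *: U n u = y n & p n = s + b n].
Hypothesis qE : forall n, q n = p n - gam n *: U n (D (p n) + c n).
Hypothesis xE : forall n, x n.+1 = x n - y n + q n.
Hypothesis zero_ex : exists z, A z (- D z).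

Let A_mono : monotone_op A. Proof. by case: A_max. Qed.

Let gam0 n : 0 < gam n.
Proof. by case/andP: (gam_itv n) => h _; exact: lt_le_trans h. Qed.

Let gam_le n : gam n <= lam. Proof. by case/andP: (gam_itv n). Qed.

Let metric n : {S | posop mu^-1 al^-1 S /\ cancel S (U n) /\ cancel (U n) S}.
Proof.
apply: constructive_indefinite_description.
by have [S [h1 h2 h3]] := posop_inverse al0 mu0 (UP n); exists S.
Qed.

Let S n := projT1 (metric n).
Let SP n : posop mu^-1 al^-1 (S n).
Proof. by rewrite /S; case: (metric n) => /= ? []. Qed.
Let SK n : cancel (S n) (U n).
Proof. by rewrite /S; case: (metric n) => /= ? [_ []]. Qed.
Let US n : cancel (U n) (S n).
Proof. by rewrite /S; case: (metric n) => /= ? [_ []]. Qed.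

Let N n v := inner (S n v) v.

Let mui0 : 0 < mu^-1. Proof. by rewrite invr_gt0. Qed.

Let N_ge0 n v : 0 <= N n v. Proof. exact: posop_ge0 (ltW mui0) (SP n) _. Qed.

Let N_ge n v : `|v| ^+ 2 <= mu * N n v.
Proof. by rewrite -ler_pdivrMl//; exact: posop_ge (SP n) _. Qed.

(** Inversion reverses the order, which turns the condition on the [U n] into a growth bound on the
    inverse metrics. *)
Let N_mono n v : N n.+1 v <= (1 + eta n) * N n v.
Proof.
apply: (inverse_antitone al0 al0 (UP n) (UP n.+1)) => //.
- exact: posop_sa (SP n).
- exact: posop_sa (SP n.+1).
- by rewrite addr_ge0// eta_sum.1.
Qed.

(* The error-free step from the actual [x n] and [w n]. *)
Let exact_step n : {pe : K * K | A pe.1 pe.2 /\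
  pe.1 + gam n *: U n pe.2 = x n - gam n *: U n (D (w n))}.
Proof.
apply: constructive_indefinite_description.
have [s [u [Asu su]]] := @minty _ _ A (gam n * al) (gam n * mu)
  (fun v => gam n *: U n v) (x n - gam n *: U n (D (w n)))
  (mulr_gt0 (gam0 n) al0) (mulr_gt0 (gam0 n) mu0)
  (posopZ (ltW (gam0 n)) (UP n)) A_max.
by exists (s, u).
Qed.

Let ph n := (projT1 (exact_step n)).1.
Let e n := (projT1 (exact_step n)).2.
Let Ape n : A (ph n) (e n).
Proof. by rewrite /ph /e; case: (exact_step n) => /= ? []. Qed.
Let phE n : ph n + gam n *: U n (e n) = x n - gam n *: U n (D (w n)).
Proof. by rewrite /ph /e; case: (exact_step n) => /= ? []. Qed.
Let xh n := ph n + gam n *: U n (D (w n) - D (ph n)).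

Let err_cst : R := (1 + lam * mu) * (1 + lam * mu * beta) + lam * mu.
Let err n := err_cst * (`|a n| + `|b n| + `|c n|).

Let lam0 : 0 < lam. Proof. exact: lt_le_trans (gam0 0) (gam_le 0). Qed.

Let err_bound n : `|p n - ph n| <= err n /\ `|x n.+1 - xh n| <= err n.
Proof.
have [s [u [Asu su ps]]] := pE n.
exact: (@fbf_perturbation _ _ A D beta A_mono D_lip al mu (gam n) lam (U n)
  (S n) (x n) (w n) (ph n) (e n) (y n) s u (p n) (q n) (x n.+1) (a n) (b n)
  (c n) (ltW beta0) al0 mu0 (gam0 n) (gam_le n) (UP n) (SP n) (US n) (Ape n)
  (phE n) (yE n) Asu su ps (qE n) (xE n)).
Qed.

Let err_sum : psummable err.
Proof.
apply: psummableZ; first by rewrite !(addr_ge0, mulr_ge0)// ltW.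
by apply: psummableD => //; exact: psummableD.
Qed.

Let err0 n : 0 <= err n. Proof. exact: err_sum.1. Qed.

(* The second term absorbs the use of [D (w n)] in place of [D (x n)]. *)
Let V z n := N n (x n - z) + N n (x n - w n).
Let gap n := N n (x n - ph n) + N n (x n - w n).

Let exact_descent z n : A z (- D z) ->
  N n (xh n - z) + N n (xh n - ph n) <= V z n - 3 / 5 * gap n.
Proof.
move=> Az; have le10 : 10 * (gam n * mu * beta) ^+ 2 <= 1.
  apply: le_trans lam_le; rewrite ler_pM2l// ler_sqr ?nnegrE.
  - by rewrite ler_pM2r// ler_pM2r.
  - by rewrite !mulr_ge0// ltW.
  - by rewrite !mulr_ge0// ltW.
exact: (fbf_step A_mono D_mono D_lip al0 mu0 (gam0 n) (UP n) (SP n) (US n) le10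
  Az (Ape n) (phE n) (erefl (xh n))).
Qed.

(** The exact descent is carried over to the true iterates by [posop_quad_perturb] and to the next
    metric by [N_mono]; the outcome has the form required by [quasi_fejer]. *)
Let V_fejer z : A z (- D z) -> cvgn (V z) /\ psummable gap.
Proof.
move=> Az.
have V0 n : 0 <= V z n by rewrite addr_ge0.
have gap0 n : 0 <= gap n by rewrite addr_ge0.
pose f n := 2 * err n.
have fS : psummable f by exact: psummableZ err_sum.
have f0 n : 0 <= f n by exact: fS.1.
pose k : R := al^-1 / mu^-1.
have k0 : 0 <= k by rewrite divr_ge0 ?invr_ge0// ltW.
have ali0 : 0 <= al^-1 by rewrite invr_ge0 ltW.
have kfS : psummable (fun n => k * f n) by exact: psummableZ.
(* [1 + t n] is the product of the metric factor [1 + eta n] and the error factor [1 + k f n]. *)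
pose t n := eta n + k * f n + eta n * (k * f n).
have tS : psummable t.
  by apply: psummableD; [exact: psummableD|exact: psummableM].
pose d0 n := 2 * (al^-1 * (f n + f n * f n)).
have d0S : psummable d0.
  apply: psummableZ => //; apply: psummableZ => //.
  by apply: psummableD => //; exact: psummableM.
pose d n := d0 n + eta n * d0 n.
have dS : psummable d by apply: psummableD => //; exact: psummableM.
have step n : V z n.+1 <= (1 + t n) * V z n - 3 / 5 * gap n + d n.
  have [e1 e2] := err_bound n.
  have h1 : N n (x n.+1 - z) <= (1 + k * f n) * N n (xh n - z) +
      al^-1 * (f n + f n ^+ 2).
    rewrite [x n.+1 - z](_ : _ = (xh n - z) + (x n.+1 - xh n)); last first.
      by apply: inner_eqP => v; rewrite !innerE; ring.
    apply: posop_quad_perturb (SP n) _ _ => //.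
    by apply: le_trans e2 _; rewrite /f; have := err0 n; lra.
  have h2 : N n (x n.+1 - p n) <= (1 + k * f n) * N n (xh n - ph n) +
      al^-1 * (f n + f n ^+ 2).
    rewrite [x n.+1 - p n](_ : _ =
        (xh n - ph n) + ((x n.+1 - xh n) - (p n - ph n))); last first.
      by apply: inner_eqP => v; rewrite !innerE; ring.
    apply: posop_quad_perturb (SP n) _ _ => //.
    by apply: le_trans (ler_normB _ _) _; rewrite /f; lra.
  (* Here [w n.+1] is [p n] by definition, so the correction term of this step is the second term of
     the next [V]. *)
  have h3 : V z n.+1 <= (1 + eta n) * (N n (x n.+1 - z) + N n (x n.+1 - p n)).
    by rewrite mulrDr; apply: lerD; exact: N_mono.
  have eta0 : 0 <= 1 + eta n by rewrite addr_ge0// eta_sum.1.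
  have kf0 : 0 <= 1 + k * f n by rewrite addr_ge0// mulr_ge0.
  have h4 := ler_wpM2l kf0 (exact_descent n Az).
  have h5 : N n (x n.+1 - z) + N n (x n.+1 - p n) <=
      (1 + k * f n) * (V z n - 3 / 5 * gap n) + d0 n.
    by move: h1 h2 h4; rewrite /d0 expr2; lra.
  have h6 := le_trans h3 (ler_wpM2l eta0 h5); apply: le_trans h6 _.
  have h7 : 0 <= t n * gap n by rewrite mulr_ge0// tS.1.
  rewrite [leLHS](_ : _ = (1 + t n) * V z n - 3 / 5 * gap n - 3 / 5 * (t n * gap n)
    + d n); first by lra.
  by rewrite /t /d; ring.
have gS0 n : 0 <= 3 / 5 * gap n by rewrite mulr_ge0.
have [Vc gS] := quasi_fejer V0 gS0 tS dS step.
split=> //.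
have -> : gap = (fun n => 5 / 3 * (3 / 5 * gap n)).
  by apply/funext => n; field.
exact: psummableZ.
Qed.

Let gap_sum : psummable gap.
Proof. by have [z /V_fejer[]] := zero_ex. Qed.

Let dist_hat : psummable (fun n => `|x n - ph n| ^+ 2).
Proof.
apply: psummable_le (psummableZ (ltW mu0) gap_sum) => n.
by rewrite exprn_ge0//= (le_trans (N_ge n _))// ler_pM2l// lerDl.
Qed.

Lemma fbf_dist_summable : psummable (fun n => `|x n - p n| ^+ 2).
Proof.
have err2 := psummableM err_sum err_sum.
have h2 : 0 <= (2 : R) by [].
apply: psummable_le (psummableD (psummableZ h2 dist_hat) (psummableZ h2 err2)).
move=> n; rewrite exprn_ge0//=.
have -> : x n - p n = (x n - ph n) + (ph n - p n) by rewrite addrA subrK.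
apply: le_trans (sqr_normD_le _ _) _; rewrite lerD2l ler_pM2l//.
by rewrite -expr2 ler_sqr ?nnegrE// distrC; case: (err_bound n).
Qed.

Let x_bounded : exists M, forall n, `|x n| <= M.
Proof.
have [z Az] := zero_ex; have [/cvg_seq_bounded Vb _] := V_fejer Az.
have [M VM] : exists M, forall n, V z n <= M.
  have [M0 [_ hM]] := Vb; exists (M0 + 1) => n.
  by apply: le_trans (ler_norm _) _; apply: (hM (M0 + 1)); rewrite ?ltrDl//=.
(* The bound uses [r <= 1 + r^2] with [r := |x n - z|]. *)
exists (1 + mu * M + `|z|) => n.
have h : `|x n - z| ^+ 2 <= mu * M.
  apply: le_trans (N_ge n _) _; rewrite ler_pM2l//; apply: le_trans (VM n).
  by rewrite lerDl.
rewrite -[x n](subrK z); apply: le_trans (ler_normD _ _) _; rewrite lerD2r.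
have : 0 <= (`|x n - z| - 1) ^+ 2 by exact: sqr_ge0.
by have : 0 <= `|x n - z| by []; lra.
Qed.

Let x_ph : x n - ph n @[n --> \oo] --> 0.
Proof. exact: psummable_sqr_norm_cvg0. Qed.

Let x_w : x n - w n @[n --> \oo] --> 0.
Proof.
apply: psummable_sqr_norm_cvg0.
apply: psummable_le (psummableZ (ltW mu0) gap_sum) => n.
by rewrite exprn_ge0//= (le_trans (N_ge n _))// ler_pM2l// lerDr.
Qed.

(** [e n + D (ph n)] is a value of [A + D] at [ph n]. Solving the step for [e n] expresses it
    through the two vanishing gaps, and [gmin] bounds the inverse step sizes. *)
Let residual : e n + D (ph n) @[n --> \oo] --> 0.
Proof.
have lipE n : e n + D (ph n) =
    (gam n)^-1 *: S n (x n - ph n) + (D (ph n) - D (w n)).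
  have -> : x n - ph n = gam n *: U n (e n + D (w n)).
    rewrite (selfadjointD _ _ (posop_sa (UP n))) scalerDr.
    apply: inner_eqP => v; have := congr1 (inner^~ v) (phE n).
    by rewrite !innerE; lra.
  rewrite (selfadjointZ _ _ (posop_sa (SP n))) US scalerA mulVf ?gt_eqF//.
  by rewrite scale1r; apply: inner_eqP => v; rewrite !innerE; ring.
apply: (cvg_norm_le (g := fun n => (gmin^-1 * al^-1 + beta) * `|x n - ph n|
  + beta * `|x n - w n|)).
  move=> n; rewrite subr0 lipE; apply: le_trans (ler_normD _ _) _.
  have h1 : `|(gam n)^-1 *: S n (x n - ph n)| <=
      gmin^-1 * al^-1 * `|x n - ph n|.
    rewrite normrZ gtr0_norm ?invr_gt0// -mulrA; apply: ler_pM => //.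
    - by rewrite invr_ge0 ltW.
    - by rewrite lef_pV2 ?posrE//; case/andP: (gam_itv n).
    - exact: posop_norm_le (ltW mui0) (SP n) _.
  have h2 : `|D (ph n) - D (w n)| <= beta * (`|x n - ph n| + `|x n - w n|).
    apply: le_trans (D_lip _ _) _; rewrite ler_pM2l//.
    have -> : ph n - w n = (x n - w n) - (x n - ph n).
      by apply: inner_eqP => v; rewrite !innerE; ring.
    by rewrite [leRHS]addrC; exact: ler_normB.
  by lra.
have n0 (f : K ^nat) : f n @[n --> \oo] --> 0 -> `|f n| @[n --> \oo] --> (0 : R).
  by move=> f0; rewrite -(normr0 K); exact: cvg_norm.
have := cvgD (cvgMl_tmp (a := gmin^-1 * al^-1 + beta) (n0 _ x_ph))
  (cvgMl_tmp (a := beta) (n0 _ x_w)).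
by rewrite !mulr0 addr0; exact.
Qed.

(* Passing to the limit in the monotonicity inequalities only shows that [- D l]
   is related to [A] up to [D y]; testing against the resolvent of [A] at
   [l - tau D l] with [tau < 1 / beta] then gives [A l (- D l)], so that the
   maximality of [A + D] is not needed. *)
Let weak_limit_zero (F : set_system nat) (l : K) : UltraFilter F ->
  \oo `<=` F -> (forall v, inner (x n) v @[n --> F] --> inner l v) ->
  A l (- D l).
Proof.
move=> FU ooF xl; have PF := @ultra_proper _ _ FU.
have [M xM] := x_bounded.
have phl v : inner (ph n) v @[n --> F] --> inner l v.
  have -> : (fun n => inner (ph n) v) =
      (fun n => inner (x n) v - inner (x n - ph n) v).
    by apply/funext => n; rewrite innerBl; ring.
  rewrite -(subr0 (inner l v)); apply: cvgB => //.
  rewrite -(inner0l v); apply: cvg_innerl.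
  by apply: cvg_trans x_ph; exact: cvg_app.
have phM : exists M', forall n, `|ph n| <= M'.
  have [M1 hM1] := psummable_bounded dist_hat.
  exists (1 + M1 + M) => n.
  have -> : ph n = (ph n - x n) + x n by rewrite subrK.
  apply: le_trans (ler_normD _ _) _; apply: lerD => //; rewrite distrC.
  have : 0 <= (`|x n - ph n| - 1) ^+ 2 by exact: sqr_ge0.
  by have := hM1 n; have : 0 <= `|x n - ph n| by []; lra.
have [M' phM'] := phM.
(* The points [ph n] converge weakly and stay bounded while the residuals converge strongly, so the
   monotonicity inequality passes to the limit. *)
have key y0 u : A y0 u -> 0 <= inner (l - y0) (- (u + D y0)).
  move=> Ayu.
  pose f n := inner (ph n - y0) (e n + D (ph n) - (u + D y0)).
  have fl : f n @[n --> F] --> inner (l - y0) (- (u + D y0)).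
    apply: (@weak_cvg_inner _ _ _ _ _ _ _ _ _ (M' + `|y0|)).
    - by move=> n; apply: le_trans (ler_normB _ _) _; rewrite lerD2r.
    - move=> v; rewrite innerBl.
      have -> : (fun n => inner (ph n - y0) v) =
        (fun n => inner (ph n) v - inner y0 v).
        by apply/funext => n; rewrite innerBl.
      by apply: cvgB => //; exact: cvg_cst.
    - have resF : e n + D (ph n) @[n --> F] --> 0.
        by apply: cvg_trans residual; exact: cvg_app.
      by have := cvgB resF (cvg_cst (u + D y0)); rewrite sub0r; exact.
  apply: (ler_cvg_to (cvg_cst 0) fl); apply: nearW => n; rewrite /f.
  have := A_mono (Ape n) Ayu; have := D_mono (ph n) y0.
  by rewrite !innerE; lra.
(* With [tau = 1 / (2 beta)] the resolvent contributes [2 beta |l - y0|^2], which exceeds the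
   Lipschitz loss [beta |l - y0|^2] unless [l = y0]. *)
pose tau : R := (2 * beta)^-1.
have tau0 : 0 < tau by rewrite invr_gt0 mulr_gt0.
have [y0 [u [Ayu yu]]] := @minty _ _ A (tau * 1) (tau * 1) (fun v => tau *: v)
  (l - tau *: D l) (mulr_gt0 tau0 ltr01) (mulr_gt0 tau0 ltr01)
  (posopZ (ltW tau0) posop_id) A_max.
have uE : u = (2 * beta) *: (l - y0) - D l.
  have -> : l - y0 = tau *: (u + D l).
    by apply: inner_eqP => v; have := congr1 (inner^~ v) yu; rewrite !innerE; lra.
  by rewrite scalerA divff ?mulf_neq0 ?gt_eqF// scale1r addrK.
have := key _ _ Ayu; rewrite uE => h.
have h1 : inner (l - y0) (D l - D y0) <= beta * `|l - y0| ^+ 2.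
  apply: le_trans (ler_inner _ _) _; rewrite expr2 mulrCA ler_wpM2l//.
have h2 : inner (l - y0) (- ((2 * beta) *: (l - y0) - D l + D y0)) =
    inner (l - y0) (D l - D y0) - 2 * beta * `|l - y0| ^+ 2.
  by rewrite -inner_sqr -innerZr -innerBr; congr inner;
    apply: inner_eqP => v; rewrite !innerE; ring.
have h3 : beta * `|l - y0| ^+ 2 <= 0 by rewrite h2 in h; lra.
have ly : l = y0.
  apply/eqP; rewrite -subr_eq0 -normr_eq0 -sqrf_eq0 eq_le exprn_ge0//.
  by rewrite pmulr_rle0 in h3; rewrite ?h3.
by move: Ayu; rewrite uE -ly subrr scaler0 sub0r.
Qed.

(* Opial's argument. Since [N n (x n - l)] and [N n (x n - l0)] converge, so does
   [inner (x n) (T n)], where [T n] is the rescaled metric applied to [l - l0]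
   and converges strongly to some [t]; the two weak limits being equal against
   [t], [inner (l - l0) t] vanishes. *)
Let x_weak_cvg : exists l, A l (- D l) /\ weak_cvg x l.
Proof.
have [M xM] := x_bounded.
have [F0 [FU0 ooF0]] := ultraFilterLemma (eventually_filter : ProperFilter \oo).
have [l0 xl0] := weak_cvg_ultra FU0 xM.
exists l0; split; first exact: weak_limit_zero FU0 ooF0 xl0.
apply: (weak_cvg_of_ultra xM) => F l FU ooF xl.
have A0 := weak_limit_zero FU0 ooF0 xl0; have Al := weak_limit_zero FU ooF xl.
pose h := l - l0.
pose pi n := \prod_(i < n) (1 + eta i).
have pi1 n : 1 <= pi n by apply: prod1D_ge1; exact: eta_sum.1.
have pi0 n : 0 < pi n by exact: lt_le_trans ltr01 (pi1 n).
have Nc v : cvgn (fun n => N n v).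
  have z0 : psummable (fun _ : nat => 0 : R).
    by split=> //; exists 0 => n; rewrite big1.
  have st n : N n.+1 v <= (1 + eta n) * N n v - 0 + 0.
    by rewrite subr0 addr0; exact: N_mono.
  by have [] := quasi_fejer (N_ge0^~ v) (fun=> lexx 0) eta_sum z0 st.
have Nw : N n (x n - w n) @[n --> \oo] --> 0.
  apply: psummable_cvg0; apply: psummable_le gap_sum => n.
  by rewrite N_ge0/= lerDr.
have Nx z : A z (- D z) -> cvgn (fun n => N n (x n - z)).
  move=> Az; have [Vc _] := V_fejer Az.
  have -> : (fun n => N n (x n - z)) = (fun n => V z n - N n (x n - w n)).
    by apply/funext => n; rewrite /V addrK.
  by apply: is_cvgB => //; apply/cvg_ex; exists 0.
pose T n := (pi n)^-1 *: S n h.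
have Tc : cvgn T by exact: scaled_metric_is_cvg (ltW mui0) SP eta_sum N_mono.
have pic : cvgn pi by exact: prod1D_is_cvg.
have pil : limn pi != 0.
  have : 1 <= limn pi by apply: limr_ge => //; exact: nearW.
  by move=> h1; rewrite gt_eqF// (lt_le_trans ltr01).
have xTc : cvgn (fun n => inner (x n) (T n)).
  (* Expanding the squares cancels [N n (x n)] and leaves [2 <S n (x n), l - l0>]; each of the four
     remaining sequences converges. *)
  have -> : (fun n => inner (x n) (T n)) = (fun n => (pi n)^-1 *
      (2^-1 * (N n (x n - l0) - N n (x n - l) + (N n l - N n l0)))).
    apply/funext => n; rewrite /T innerZr; congr (_ * _).
    have sS := posop_sa (SP n); rewrite -sS /N /h.
    rewrite !(inner_quadD _ _ sS) !(inner_quadN _ sS) !innerNr innerBr.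
    by field.
  apply: is_cvgM; first by apply: is_cvgV.
  by apply: is_cvgM; [exact: is_cvg_cst|apply: is_cvgD; apply: is_cvgB; auto].
have /cvg_ex[t Tt] := Tc; have /cvg_ex[r xTr] := xTc.
have lim_eq G l' : UltraFilter G -> \oo `<=` G ->
    (forall v, inner (x n) v @[n --> G] --> inner l' v) -> inner l' t = r.
  move=> GU ooG xl'; have PG := @ultra_proper _ _ GU.
  have h1 : inner (x n) (T n) @[n --> G] --> inner l' t.
    apply: (weak_cvg_inner xM xl').
    by apply: cvg_trans Tt; exact: cvg_app.
  apply: (cvg_unique (@norm_hausdorff _ R^o) h1).
  by apply: cvg_trans xTr; exact: cvg_app.
have ht : inner h t = 0.
  by rewrite innerBl (lim_eq F) ?(lim_eq F0)// subrr.
have [P piP] := psummable_prod_bounded eta_sum.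
have P0 : 0 < P by exact: lt_le_trans (pi0 0) (piP 0).
(* The rescaled metrics are uniformly coercive because the products stay below [P], so [<h, t>]
   controls [|h|^2]. *)
have hT : `|h| ^+ 2 / (mu * P) <= inner h t.
  have hTt : inner h (T n) @[n --> \oo] --> inner h t.
    by apply: cvg_inner => //; exact: cvg_cst.
  apply: (ler_cvg_to (cvg_cst _) hTt); apply: nearW => n.
  rewrite /T innerZr innerC invfM mulrA mulrC.
  apply: ler_pM.
  - by rewrite invr_ge0 ltW.
  - by apply: divr_ge0; [exact: exprn_ge0|exact: ltW].
  - by rewrite lef_pV2 ?posrE//; exact: piP.
  - by rewrite ler_pdivrMr// mulrC; exact: N_ge.
apply/eqP; rewrite -subr_eq0 -/h -normr_eq0 -sqrf_eq0 eq_le exprn_ge0// andbT.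
by move: hT; rewrite ht ler_pdivrMr ?mulr_gt0// mul0r.
Qed.

Lemma fbf_weak_cvg :
  exists l, [/\ A l (- D l), weak_cvg x l & weak_cvg p l].
Proof.
have [l [Al xl]] := x_weak_cvg; exists l; split=> // v.
have -> : (fun n => inner (p n) v) = (fun n => inner (x n) v - inner (x n - p n) v).
  by apply/funext => n; rewrite innerBl; ring.
rewrite -(subr0 (inner l v)); apply: cvgB; first exact: xl.
rewrite -(inner0l v); apply: cvg_innerl.
exact: psummable_sqr_norm_cvg0 fbf_dist_summable.
Qed.

End FbfSequence.

(** * Product operators, coordinates and resolvents *)

Section HilbertSumOperators.
Context {R : realType}.

Lemma ler_sum_sqr (I : finType) (a : I -> R) : (forall i, 0 <= a i) ->
  \sum_i a i ^+ 2 <= (\sum_i a i) ^+ 2.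
Proof.
move=> a0; rewrite expr2 mulr_suml; apply: ler_sum => i _; rewrite expr2.
by rewrite ler_wpM2l// (bigD1 i)//= lerDl sumr_ge0.
Qed.

Lemma sum_CS (I : finType) (a b : I -> R) :
  (\sum_i a i * b i) ^+ 2 <= (\sum_i a i ^+ 2) * (\sum_i b i ^+ 2).
Proof.
apply: quadratic_ge0_discriminant => [|t].
  by apply: sumr_ge0 => i _; exact: sqr_ge0.
have -> : (\sum_i a i ^+ 2) * t ^+ 2 + 2 * (\sum_i a i * b i) * t +
    \sum_i b i ^+ 2 = \sum_i (t * a i + b i) ^+ 2.
  rewrite mulr_suml mulr_sumr mulr_suml -!big_split; apply: eq_bigr => i _ /=.
  by ring.
by apply: sumr_ge0 => i _; exact: sqr_ge0.
Qed.

Lemma big_option (I : finType) (F : option I -> R) :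
  \sum_o F o = F None + \sum_i F (Some i).
Proof.
rewrite (bigD1 None)//=; congr (_ + _).
rewrite (reindex_omap (@Some I) id) => [|[]//].
by apply: eq_bigl => i; rewrite eqxx.
Qed.

Lemma hsum_norm_le_sum (I : finType) (K : I -> hilbertType R) (x : hsum K) :
  `|x| <= \sum_i `|x i|.
Proof.
rewrite -ler_sqr ?nnegrE ?sumr_ge0// hsum_sqr_norm.
by apply: (@ler_sum_sqr _ (fun i => `|x i|)).
Qed.

(** The equation [x + u = w] is solved coordinate by coordinate with Minty's theorem, and its
    converse gives maximality. *)
Lemma max_monotone_hsum (I : finType) (K : I -> hilbertType R)
    (A : forall i, K i -> set (K i)) : (forall i, max_monotone_op (A i)) ->
  max_monotone_op (fun x : hsum K => [set u : hsum K | forall i, A i (x i) (u i)]).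
Proof.
move=> AM; apply: minty_max_monotone.
  move=> x y u v xu yv; rewrite hsum_innerE; apply: sumr_ge0 => i _.
  have [Am _] := (max_monotoneP (A i)).1 (AM i).
  exact: Am (xu i) (yv i).
move=> w.
have h i : {p : K i * K i | A i p.1 p.2 /\ p.1 + p.2 = w i}.
  apply: constructive_indefinite_description.
  have [x [u [Axu xu]]] := minty (w i) ltr01 ltr01 posop_id (AM i).
  by exists (x, u).
exists (fun i => (projT1 (h i)).1), (fun i => (projT1 (h i)).2).
split=> [i|]; first by case: (h i) => /= ? [].
have hE i : (projT1 (h i)).1 + (projT1 (h i)).2 = w i.
  by case: (h i) => /= ? [].
by apply: hsumP => i; exact: hE.
Qed.

Lemma weak_cvg_hsum (I : finType) (K : I -> hilbertType R) (x : (hsum K) ^nat)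
    (l : hsum K) i : weak_cvg x l -> weak_cvg (fun n => x n i) (l i).
Proof.
move=> xl w.
(* The test vector is [w] in coordinate [i] and [0] elsewhere; the cast transports [w] along
   [j = i]. *)
pose e : hsum K := fun j => if pselect (j = i) is left ji
  then ecast k (K k) (esym ji) w else 0.
have eE (y : hsum K) : inner y e = inner (y i) w.
  rewrite hsum_innerE (bigD1 i)//= big1 ?addr0 => [|j ji].
    rewrite /e; case: pselect => // ii.
    by rewrite (Prop_irrelevance ii (erefl i)).
  rewrite /e; case: pselect => [ji'|_]; last by rewrite inner0r.
  by move/eqP: ji.
have -> : (fun n => inner (x n i) w) = (fun n => inner (x n) e).
  by apply/funext => n; rewrite eE.
by rewrite -eE; exact: xl.
Qed.

(** Minty's theorem makes the resolvent set nonempty, so [xget] returns one of its elements and not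
    the default [0]. *)
Lemma resolvent_mapP (K : hilbertType R) (A : K -> set K) (a M g : R) (U : K -> K)
    (y : K) : 0 < a -> 0 < M -> 0 < g -> posop a M U -> max_monotone_op A ->
  let s := resolvent_map (scale_op g U A) y in
  exists u, A s u /\ s + g *: U u = y.
Proof.
move=> a0 M0 g0 UP AM /=; rewrite /resolvent_map.
have [s [u [Asu su]]] := minty y (mulr_gt0 g0 a0) (mulr_gt0 g0 M0)
  (posopZ (ltW g0) UP) AM.
have : resolvent (scale_op g U A) y (xget 0 (resolvent (scale_op g U A) y)).
  apply: xgetPex; exists s; exists s => //.
  by exists (g *: U u) => //; exists u.
set t := xget _ _; case=> t' tt' [_ [v Atv <-]] E.
by exists v; split=> //; rewrite -[RHS]E tt'.
Qed.

End HilbertSumOperators.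

(** Some tail has a positive infimum, and the finitely many terms before it have a positive
    minimum. *)
Lemma liminf_gt0_lower_bound {R : realType} (u : R ^nat) :
  (forall n, 0 < u n) -> (0 < limn_einf (fun n => (u n)%:E))%E ->
  exists2 g, 0 < g & forall n, g <= u n.
Proof.
move=> u0; rewrite limn_einf_lim (cvg_lim _ (@cvg_einfs_sup _ _))//.
move=> /ereal_sup_gt[_ [N _ <-]] /= gN.
set I := einfs _ N in gN.
have IN n : (N <= n)%N -> (I <= (u n)%:E)%E.
  by move=> Nn; apply: ereal_inf_lbound; exists n.
have Ifin : I \is a fin_num.
  by rewrite ge0_fin_numE ?ltW// (le_lt_trans (IN N (leqnn N)))// ltry.
have [g g0 gu] : exists2 g, 0 < g & forall n, (n < N)%N -> g <= u n.
  elim: (N) => [|k [g g0 gu]]; first by exists 1.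
  exists (Num.min g (u k)); first by rewrite lt_min g0 u0.
  move=> n; rewrite ltnS leq_eqVlt => /orP[/eqP ->|nk].
    by rewrite ge_min lexx orbT.
  by rewrite ge_min gu.
exists (Num.min g (fine I)).
  by rewrite lt_min g0 fine_gt0// gN ltey_eq Ifin.
move=> n; have [nN|Nn] := ltnP n N; first by rewrite ge_min gu.
by rewrite ge_min; apply/orP; right; rewrite -lee_fin fineK// IN.
Qed.

(** * The primal-dual pair *)

Section PrimalDual.
Context {R : realType} {H : hilbertType R} {m : nat} (G : 'I_m -> hilbertType R).

(* The index [None] stands for the primal space, [Some i] for the i-th dual one. *)
Definition pd_space (o : option 'I_m) : hilbertType R :=
  if o is Some i then G i else H.

Definition pd_pair (x : H) (v : forall i, G i) : hsum pd_space :=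
  fun o => match o return pd_space o with Some i => v i | None => x end.

Lemma pd_innerE (X Y : hsum pd_space) : inner X Y =
  inner (X None : H) (Y None) + \sum_i inner (X (Some i) : G i) (Y (Some i)).
Proof. by rewrite hsum_innerE big_option. Qed.

Lemma pd_sqr_norm (X : hsum pd_space) : `|X| ^+ 2 =
  `|X None : H| ^+ 2 + \sum_i `|X (Some i) : G i| ^+ 2.
Proof. by rewrite hsum_sqr_norm big_option. Qed.

Section Skew.
Variables (C : H -> H) (v0 : R) (L : forall i, {linear H -> G i}).
Hypothesis C_mono : monotone_op (single_op C).
Hypothesis v0_ge0 : 0 <= v0.
Hypothesis C_lip : forall x y, `|C x - C y| <= v0 * `|x - y|.
Hypothesis L_bnd : forall i, bounded_op (L i).

Definition pd_map (X : hsum pd_space) : hsum pd_space :=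
  pd_pair (C (X None) + \sum_(i < m) adjoint (L i) (X (Some i)))
          (fun i => - L i (X None)).

Lemma inner_sum_adjoint (d : H) (v w : forall i, G i) :
  inner d (\sum_(i < m) adjoint (L i) (v i) - \sum_(i < m) adjoint (L i) (w i)) =
  \sum_i inner (L i d) (v i - w i).
Proof.
rewrite innerC innerBl !inner_sum -sumrB; apply: eq_bigr => i _.
by rewrite innerBr !(adjointP _ _ (L_bnd i)) !(innerC d).
Qed.

(** The cross terms of the skew part cancel, which leaves the monotonicity of [C]. *)
Lemma pd_map_mono (X Y : hsum pd_space) :
  0 <= inner (X - Y) (pd_map X - pd_map Y).
Proof.
pose x : H := X None; pose y : H := Y None.
pose v i : G i := X (Some i); pose w i : G i := Y (Some i).
have -> : inner (X - Y) (pd_map X - pd_map Y) = inner (x - y) (C x - C y).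
  rewrite pd_innerE.
  change (inner (x - y) (C x + \sum_(i < m) adjoint (L i) (v i) -
      (C y + \sum_(i < m) adjoint (L i) (w i))) +
     \sum_i inner (v i - w i) (- L i x - - L i y) = inner (x - y) (C x - C y)).
  rewrite opprD addrACA [in LHS]innerDr inner_sum_adjoint -addrA -big_split /=.
  rewrite big1 ?addr0// => i _; rewrite -opprD innerNr -linearB innerC.
  by rewrite subrr.
exact: C_mono.
Qed.

(** The difference splits into the part from [C], with constant [v0], and the skew part, whose two
    components are bounded separately with the same constant [Lam] and added in squares. *)
Lemma pd_map_lip (X Y : hsum pd_space) : `|pd_map X - pd_map Y| <=
  (v0 + Num.sqrt (\sum_(i < m) opnorm (L i) ^+ 2)) * `|X - Y|.
Proof.
set Lam := Num.sqrt _.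
have Lam2 : Lam ^+ 2 = \sum_(i < m) opnorm (L i) ^+ 2.
  by rewrite sqr_sqrtr// sumr_ge0// => i _; exact: sqr_ge0.
pose x : H := X None; pose y : H := Y None.
pose v i : G i := X (Some i); pose w i : G i := Y (Some i).
pose s := \sum_(i < m) adjoint (L i) (v i) - \sum_(i < m) adjoint (L i) (w i).
have -> : pd_map X - pd_map Y =
    pd_pair (C x - C y) (fun i => 0) + pd_pair s (fun i => - L i (x - y)).
  apply: hsumP => -[i|].
    change (- L i x - - L i y = 0 + - L i (x - y)).
    by rewrite add0r linearB opprB opprK addrC.
  change (C x + \sum_(i < m) adjoint (L i) (v i) -
    (C y + \sum_(i < m) adjoint (L i) (w i)) = C x - C y + s).
  by rewrite opprD addrACA.
have XY2 : `|X - Y| ^+ 2 = `|x - y| ^+ 2 + \sum_i `|v i - w i| ^+ 2.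
  exact: pd_sqr_norm.
have h1 : `|pd_pair (C x - C y) (fun i => 0)| <= v0 * `|X - Y|.
  apply: (@le_trans _ _ (v0 * `|x - y|)).
    apply: le_trans (C_lip x y).
    rewrite -ler_sqr ?nnegrE// pd_sqr_norm /= big1 ?addr0// => i _.
    by rewrite normr0 expr0n.
  rewrite ler_wpM2l// -ler_sqr ?nnegrE// XY2 lerDl.
  by apply: sumr_ge0 => i _; exact: exprn_ge0.
(* [|s|^2 = <s, s>] is unfolded through the adjoints, so that only the norms of the [L i] appear. *)
have sle : `|s| <= \sum_i opnorm (L i) * `|v i - w i|.
  have [->|s0] := eqVneq s 0.
    rewrite normr0 sumr_ge0// => i _; rewrite mulr_ge0//.
    exact: opnorm_ge0.
  have sp : 0 < `|s| by rewrite normr_gt0.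
  rewrite -(ler_pM2l sp) -expr2 -inner_sqr {2}/s inner_sum_adjoint mulr_sumr.
  apply: ler_sum => i _; apply: le_trans (ler_inner _ _) _.
  by rewrite mulrA (mulrC `|s|) ler_wpM2r// opnormP.
have h2 : `|pd_pair s (fun i => - L i (x - y))| <= Lam * `|X - Y|.
  rewrite -ler_sqr ?nnegrE ?mulr_ge0 ?sqrtr_ge0// exprMn Lam2 XY2 mulrDr.
  rewrite pd_sqr_norm /= addrC; apply: lerD.
    rewrite mulr_suml; apply: ler_sum => i _; rewrite normrN -exprMn.
    by rewrite ler_sqr ?nnegrE ?mulr_ge0 ?opnorm_ge0// opnormP.
  apply: le_trans (sum_CS _ _).
  rewrite ler_sqr ?nnegrE// sumr_ge0// => i _.
  by rewrite mulr_ge0// opnorm_ge0.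
by apply: le_trans (ler_normD _ _) _; rewrite mulrDl lerD.
Qed.

End Skew.

Lemma pd_pair_norm_psummable (a : H ^nat) (b : forall i, (G i) ^nat) :
  abs_summable a -> (forall i, abs_summable (b i)) ->
  psummable (fun n => `|pd_pair (a n) (fun i => b i n)|).
Proof.
move=> aS bS.
have {}aS : psummable (fun n => `|a n|) by apply/psummableP.
have {}bS i : psummable (fun n => `|b i n|) by apply/psummableP => //; exact: bS.
apply: psummable_le (psummableD aS (psummable_sum bS)) => n.
by rewrite normr_ge0/= (le_trans (hsum_norm_le_sum _))// big_option.
Qed.

End PrimalDual.

(** * Reduction to one inclusion in the direct sum *)

Theorem corollary12 (R : realType) (H : hilbertType R) (m : nat)
  (m_gt0 : (0 < m)%N) (z : H)
  (A : H -> set H) (A_max : max_monotone_op A)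
  (C : H -> H) (C_mon : monotone_op (single_op C))
  (v0 : R) (v0_gt0 : 0 < v0) (C_lip : v0.-lipschitz C)
  (G : 'I_m -> hilbertType R) (r : forall i, G i)
  (B : forall i, G i -> set (G i)) (B_max : forall i, max_monotone_op (@B i))
  (L : forall i, {linear H -> G i}) (L_bnd : forall i, bounded_op (L i))
  (L_neq0 : forall i, exists x, L i x != 0)
  (z_ran : ran_op (primal_op A C B L r) z)
  (alpha : R) (alpha_gt0 : 0 < alpha)
  (eta0 : R ^nat) (eta0_l1 : l1_plus eta0)
  (U : nat -> {linear H -> H}) (U_P : forall n, Pclass alpha (U n))
  (eta : 'I_m -> R ^nat) (eta_l1 : forall i, l1_plus (eta i))
  (Ui : forall i, nat -> {linear G i -> G i})
  (Ui_P : forall i n, Pclass alpha (Ui i n))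
  (norms : set R)
  (normsE : norms = [set opnorm (U n) | n in setT] `|`
                    [set s | exists i n, s = opnorm (Ui i n)])
  (norms_bnd : has_ubound norms)
  (mu : R) (muE : mu = sup norms)
  (U_mono : forall n, loewner_ge (fun x => (1 + eta0 n) *: U n.+1 x) (U n))
  (Ui_mono : forall i n,
    loewner_ge (fun x => (1 + eta i n) *: Ui i n.+1 x) (Ui i n))
  (a1 b1 c1 : H ^nat)
  (a1_sum : abs_summable a1) (b1_sum : abs_summable b1)
  (c1_sum : abs_summable c1)
  (a2 b2 c2 : forall i, (G i) ^nat)
  (a2_sum : forall i, abs_summable (a2 i))
  (b2_sum : forall i, abs_summable (b2 i))
  (c2_sum : forall i, abs_summable (c2 i))
  (beta : R) (betaE : beta = v0 + Num.sqrt (\sum_(i < m) opnorm (L i) ^+ 2))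
  (p1_m1 : H) (p2_m1 : forall i, G i)
  (lambda : R) (lambda_lt : lambda < 1 / (Num.sqrt 10 * mu * beta))
  (gamma : R ^nat) (gamma_itv : forall n, 0 < gamma n <= lambda)
  (gamma_liminf : (0 < limn_einf (fun n => (gamma n)%:E))%E)
  (x y1 p1 q1 : H ^nat) (v y2 p2 q2 : forall i, (G i) ^nat)
  (y1E : forall n, y1 n =
     x n - gamma n *: U n (C (prev_term p1_m1 p1 n)
       + \sum_(i < m) adjoint (L i) (prev_term (p2_m1 i) (p2 i) n) + a1 n))
  (y2E : forall n i, y2 i n =
     v i n + gamma n *: Ui i n (L i (prev_term p1_m1 p1 n) + a2 i n))
  (p2E : forall n i, p2 i n =
     resolvent_map (scale_op (gamma n) (Ui i n) (inv_op (@B i)))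
       (y2 i n - gamma n *: Ui i n (r i)) + b2 i n)
  (p1E : forall n, p1 n =
     resolvent_map (scale_op (gamma n) (U n) A) (y1 n + gamma n *: U n z) + b1 n)
  (q2E : forall n i, q2 i n =
     p2 i n + gamma n *: Ui i n (L i (p1 n) + c2 i n))
  (vE : forall n i, v i n.+1 = v i n - y2 i n + q2 i n)
  (q1E : forall n, q1 n =
     p1 n - gamma n *: U n (C (p1 n)
       + \sum_(i < m) adjoint (L i) (p2 i n) + c1 n))
  (xE : forall n, x n.+1 = x n - y1 n + q1 n) :
  [/\ (\sum_(n <oo) (`|x n - p1 n| ^+ 2)%:E < +oo)%E,
      (forall i, \sum_(n <oo) (`|v i n - p2 i n| ^+ 2)%:E < +oo)%E
    & exists (xbar : H) (vbar : forall i, G i),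
        [/\ primal_sol z A C B L r xbar,
            dual_sol z A C B L r vbar,
            weak_cvg x xbar /\ weak_cvg p1 xbar
          & forall i, weak_cvg (v i) (vbar i) /\ weak_cvg (p2 i) (vbar i)]].
Proof.
(* A nonzero [L i0] makes [H] nontrivial, and a nonzero vector of [H] forces [0 < alpha <= mu]. *)
pose i0 := Ordinal m_gt0.
have [h Lh0] := L_neq0 i0.
have hp : 0 < `|h|.
  by rewrite normr_gt0; apply: contra_neq Lh0 => ->; rewrite linear0.
have norm_mu V : norms V -> V <= mu by rewrite muE; exact: ub_le_sup.
have Umu n : opnorm (U n) <= mu by apply: norm_mu; rewrite normsE; left; exists n.
have Uimu i n : opnorm (Ui i n) <= mu.
  by apply: norm_mu; rewrite normsE; right; exists i, n.
have posopP (V : hilbertType R) (T : {linear V -> V}) :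
    Pclass alpha T -> opnorm T <= mu -> posop alpha mu T.
  move=> [Tb Ts Ta] Tmu; split=> // y; apply/andP; split.
    by rewrite -inner_sqr -innerZl; exact: Ta.
  apply: le_trans (ler_inner _ _) _; rewrite expr2 mulrA ler_wpM2r//.
  by apply: le_trans (opnormP _ Tb) _; rewrite ler_wpM2r.
have UP n : posop alpha mu (U n) by exact: posopP.
have UiP i n : posop alpha mu (Ui i n) by exact: posopP.
have mu0 : 0 < mu.
  have := le_trans (posop_ge (UP 0) h) (posop_le (UP 0) h).
  by rewrite ler_pM2r ?exprn_gt0// => /(lt_le_trans alpha_gt0).
have beta0 : 0 < beta by rewrite betaE ltr_wpDr ?sqrtr_ge0.
have C_lip' u w : `|C u - C w| <= v0 * `|u - w| by exact: (C_lip (u, w)).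
have [g g0 gg] := @liminf_gt0_lower_bound _ gamma
  (fun n => (andP (gamma_itv n)).1) gamma_liminf.
have gam0 n : 0 < gamma n by case/andP: (gamma_itv n).
have gl n : g <= gamma n <= lambda.
  by rewrite gg; case/andP: (gamma_itv n).
have lam0 : 0 < lambda by apply: lt_le_trans g0 _; case/andP: (gl 0) => /le_trans; exact.
have lam_le : 10 * (lambda * mu * beta) ^+ 2 <= 1.
  have s10 : 0 < Num.sqrt 10 :> R by rewrite sqrtr_gt0.
  have : lambda * (Num.sqrt 10 * mu * beta) < 1.
    by rewrite -ltr_pdivlMr// !mulr_gt0.
  have -> : 10 * (lambda * mu * beta) ^+ 2 =
      (lambda * (Num.sqrt 10 * mu * beta)) ^+ 2.
    by rewrite !exprMn sqr_sqrtr//; ring.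
  by move=> /ltW h1; rewrite expr_le1// !mulr_ge0// ltW.
pose K := hsum (pd_space (H := H) G).
(* The shifts move [z] and the [r i] into the operators; the additions of [0] match the form of
   [max_monotone_shift]. *)
pose Ao o : pd_space (H := H) G o -> set (pd_space (H := H) G o) :=
  match o with
  | None => fun y => [set u | A (y + 0) (u + z)]
  | Some i => fun y => [set u | inv_op (@B i) (y + 0) (u + - r i)]
  end.
have AoM o : max_monotone_op (Ao o).
  case: o => [i|]; last exact: (max_monotone_shift 0 z A_max).
  exact: (max_monotone_shift 0 (- r i) (max_monotone_inv (B_max i))).
pose A' : K -> set K := fun X => [set u | forall o, Ao o (X o) (u o)].
have A'max : max_monotone_op A' by exact: max_monotone_hsum AoM.
pose D : K -> K := pd_map C L.
pose Uo n o : pd_space (H := H) G o -> pd_space (H := H) G o :=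
  match o with None => U n | Some i => Ui i n end.
have UoP n o : posop alpha mu (Uo n o) by case: o => [i|]; [exact: UiP|exact: UP].
pose U' n : K -> K := fun X o => Uo n o (X o).
have U'P n : posop alpha mu (U' n) by exact: posop_hsum (UoP n).
(* One sequence must serve all coordinates; the sum dominates each term and stays summable. *)
pose eta' n := eta0 n + \sum_i eta i n.
have eta0S : psummable eta0 by case: eta0_l1 => h1 h2; apply/psummableP.
have etaS i : psummable (eta i) by case: (eta_l1 i) => h1 h2; apply/psummableP.
have eta'S : psummable eta' by apply: psummableD => //; exact: psummable_sum.
have U'mono n X : inner (U' n X) X <= (1 + eta' n) * inner (U' n.+1 X) X.
  rewrite !pd_innerE mulrDr mulr_sumr; apply: lerD.
    have := U_mono n (X None); rewrite innerZl => /le_trans; apply.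
    rewrite ler_wpM2r ?(posop_ge0 (ltW alpha_gt0) (UP n.+1))// lerD2l lerDl.
    by apply: sumr_ge0 => i _; exact: (etaS i).1.
  apply: ler_sum => i _.
  have := Ui_mono i n (X (Some i)); rewrite innerZl => /le_trans; apply.
  rewrite ler_wpM2r ?(posop_ge0 (ltW alpha_gt0) (UiP i n.+1))// lerD2l.
  rewrite /eta' (bigD1 i)//= addrCA lerDl addr_ge0 ?eta0S.1// sumr_ge0// => j _.
  exact: (etaS j).1.
pose pr u w : K := pd_pair (H := H) (G := G) u w.
pose X n := pr (x n) (fun i => v i n); pose Y n := pr (y1 n) (fun i => y2 i n).
pose P n := pr (p1 n) (fun i => p2 i n); pose Q n := pr (q1 n) (fun i => q2 i n).
(* The dual component of [D] is [- L i], so the errors [a2] and [c2] enter with the opposite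
   sign. *)
pose a n := pr (a1 n) (fun i => - a2 i n).
pose b n := pr (b1 n) (fun i => b2 i n).
pose c n := pr (c1 n) (fun i => - c2 i n).
have absN (V : hilbertType R) (s : V ^nat) :
    abs_summable s -> abs_summable (fun n => - s n).
  by rewrite /abs_summable /=; under [X in _ -> is_true (X < _)%E]eq_eseriesr do rewrite normrN.
have aS : psummable (fun n => `|a n|).
  by apply: pd_pair_norm_psummable => // i; exact: absN.
have bS : psummable (fun n => `|b n|) by exact: pd_pair_norm_psummable.
have cS : psummable (fun n => `|c n|).
  by apply: pd_pair_norm_psummable => // i; exact: absN.
pose Pm1 := pr p1_m1 p2_m1.
have prevN n : prev_term Pm1 P n None = prev_term p1_m1 p1 n by case: n.
have prevS n i : prev_term Pm1 P n (Some i) = prev_term (p2_m1 i) (p2 i) n.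
  by case: n.
have YE n : Y n = X n - gamma n *: U' n (D (prev_term Pm1 P n) + a n).
  apply: hsumP => -[i|].
    change (y2 i n = v i n - gamma n *: Ui i n (- L i (prev_term Pm1 P n None)
      + - a2 i n)).
    by rewrite y2E prevN -opprD linearN scalerN opprK.
  change (y1 n = x n - gamma n *: U n (C (prev_term Pm1 P n None) +
    \sum_(i < m) adjoint (L i) (prev_term Pm1 P n (Some i)) + a1 n)).
  by rewrite y1E prevN; under [in RHS]eq_bigr do rewrite prevS.
have PE n : exists s u, [/\ A' s u, s + gamma n *: U' n u = Y n & P n = s + b n].
  have [u [Au uE]] := resolvent_mapP (y1 n + gamma n *: U n z) alpha_gt0 mu0
    (gam0 n) (UP n) A_max.
  have hi i := resolvent_mapP (y2 i n - gamma n *: Ui i n (r i)) alpha_gt0 mu0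
    (gam0 n) (UiP i n) (max_monotone_inv (B_max i)).
  pose w i := projT1 (cid (hi i)).
  have wP i := projT2 (cid (hi i)).
  (* The values [u - z] and [w i + r i] undo the shifts built into [A'], which restores [y1 n] and
     [y2 i n] as right-hand sides. *)
  exists (pr (resolvent_map (scale_op (gamma n) (U n) A) (y1 n + gamma n *: U n z))
     (fun i => resolvent_map (scale_op (gamma n) (Ui i n) (inv_op (@B i)))
       (y2 i n - gamma n *: Ui i n (r i)))), (pr (u - z) (fun i => w i + r i)).
  split.
  - move=> -[i|] /=; last by rewrite addr0 subrK.
    by rewrite addr0 addrK; exact: (wP i).1.
  - apply: hsumP => -[i|].
      change (resolvent_map (scale_op (gamma n) (Ui i n) (inv_op (@B i)))
        (y2 i n - gamma n *: Ui i n (r i)) + gamma n *: Ui i n (w i + r i) = y2 i n).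
      by rewrite linearD scalerDr addrA (wP i).2 subrK.
    change (resolvent_map (scale_op (gamma n) (U n) A) (y1 n + gamma n *: U n z)
      + gamma n *: U n (u - z) = y1 n).
    by rewrite linearB scalerBr addrA uE addrK.
  - by apply: hsumP => -[i|]; [exact: p2E|exact: p1E].
have QE n : Q n = P n - gamma n *: U' n (D (P n) + c n).
  apply: hsumP => -[i|]; last exact: q1E.
  change (q2 i n = p2 i n - gamma n *: Ui i n (- L i (p1 n) + - c2 i n)).
  by rewrite q2E -opprD linearN scalerN opprK.
have XE n : X n.+1 = X n - Y n + Q n.
  by apply: hsumP => -[i|]; [exact: vE|exact: xE].
have Dmono := pd_map_mono C_mon L_bnd.
have Dlip W Z : `|D W - D Z| <= beta * `|W - Z|.
  by rewrite betaE; apply: pd_map_lip => //; exact: ltW.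
(* A zero of [A' + D] is a primal point together with matching multipliers; solutions of both (P)
   and (D) are read off from it. *)
have zero_primal (l : K) : A' l (- D l) <->
    A (l None) (z - \sum_(i < m) adjoint (L i) (l (Some i)) - C (l None)) /\
    forall i, B i (L i (l None) - r i) (l (Some i)).
  have zE : z - \sum_(i < m) adjoint (L i) (l (Some i)) - C (l None) =
      - (C (l None) + \sum_(i < m) adjoint (L i) (l (Some i))) + z.
    by rewrite addrC opprD addrA [in RHS]addrC addrA addrAC addrC addrA.
  split=> [Al|[A1 B1] [i|]].
  - split=> [|i]; first by have := Al None; rewrite /= addr0 zE.
    have := Al (Some i).
    change (B i (- - L i (l None) + - r i) (l (Some i) + 0) ->
      B i (L i (l None) - r i) (l (Some i))).
    by rewrite opprK addr0.
  - change (B i (- - L i (l None) + - r i) (l (Some i) + 0)).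
    by rewrite opprK addr0; exact: B1.
  - change (A (l None + 0)
      (- (C (l None) + \sum_(i < m) adjoint (L i) (l (Some i))) + z)).
    by rewrite addr0 -zE.
(* The range condition gives a primal point, and the elements of the [B i] chosen there are the dual
   coordinates of a zero. *)
have zeroE : exists Z, A' Z (- D Z).
  case: z_ran => x' [_ [s As [_ [w' w'B <-] <-]] [_ -> zE]].
  have wE i : exists w, B i (L i x' - r i) w /\ adjoint (L i) w = w' i.
    by have [w Bw wi] := w'B i; exists w.
  pose w i := projT1 (cid (wE i)).
  have wP i : B i (L i x' - r i) (w i) /\ adjoint (L i) (w i) = w' i :=
    projT2 (cid (wE i)).
  exists (pr x' w); apply/zero_primal; split=> [|i]; last exact: (wP i).1.
  rewrite /= -zE; under eq_bigr do rewrite (wP _).2.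
  by rewrite addrAC addrK addrK.
have summ := fbf_dist_summable A'max Dmono Dlip beta0 alpha_gt0 mu0 g0 U'P eta'S
  U'mono gl lam_le aS bS cS YE PE QE XE zeroE.
have [l [Al Xl Pl]] := fbf_weak_cvg A'max Dmono Dlip beta0 alpha_gt0 mu0 g0 U'P
  eta'S U'mono gl lam_le aS bS cS YE PE QE XE zeroE.
have summ_o o : psummable (fun n => `|X n o - P n o| ^+ 2).
  apply: psummable_le summ => n; rewrite exprn_ge0//= ler_sqr ?nnegrE//.
  exact: (ler_hsum_norm (X n - P n) o).
split.
- by apply/psummableP => [n|]; [exact: exprn_ge0|exact: (summ_o None)].
- by move=> i; apply/psummableP => [n|]; [exact: exprn_ge0|exact: (summ_o (Some i))].
have [A1 B1] := (zero_primal l).1 Al.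
exists (l None), (fun i => l (Some i)); split.
- exists (z - C (l None)); last by exists (C (l None)) => //; rewrite subrK.
  exists (z - \sum_(i < m) adjoint (L i) (l (Some i)) - C (l None)) => //.
  exists (\sum_(i < m) adjoint (L i) (l (Some i))).
    exists (fun i => adjoint (L i) (l (Some i))) => // i.
    by exists (l (Some i)).
  by rewrite addrAC subrK.
- exists (l None); split=> //.
  exists (z - \sum_(i < m) adjoint (L i) (l (Some i)) - C (l None)) => //.
  by exists (C (l None)) => //; rewrite subrK.
- by split; [exact: (weak_cvg_hsum (i := None) Xl)|
    exact: (weak_cvg_hsum (i := None) Pl)].
- by move=> i; split; [exact: (weak_cvg_hsum (i := Some i) Xl)|
    exact: (weak_cvg_hsum (i := Some i) Pl)].
Qed.
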